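(* Assume $\kappa=\kappa^{<\kappa}$. For every point $x$ of $S_\kappa$, the Stone–Čech remainder $(S_\kappa\setminus\{x\})^*$ is a $\kappa^+$-Parovičenko space of weight $2^\kappa$.
   Context: A space is zero-dimensional if it has a base of clopen sets. For a zero-dimensional space $X$ and an open $U\subseteq X$, the ($X$-)type $\tau(U)$ is the least cardinal $\tau$ such that $U$ is a union of $\tau$ many clopen subsets of $X$. A zero-dimensional space is an $F_\lambda$-space if every open subset of type less than $\lambda$ is $C^*$-embedded (every bounded continuous real-valued function on it extends continuously to the whole space). A space is a $G_\lambda$-space if every non-empty intersection of fewer than $\lambda$ open sets has non-empty interior. A $\lambda$-Parovičenko space is a compact Hausdorff zero-dimensional $F_\lambda$- and $G_\lambda$-space without isolated points (no weight restriction is imposed). If $\kappa=\kappa^{<\kappa}$ there is, up to homeomorphism, a unique $\kappa$-Parovičenko space of weight $\kappa$; it is denoted $S_\kappa$. For a Tychonoff space $X$, $X^*=\beta X\setminus X$ denotes its Stone–Čech remainder. *)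

(* Defs.v *)
From Stdlib Require Import Reals List.
Open Scope R_scope.

Set Implicit Arguments.

Definition card_le (A B : Type) : Prop :=
  exists f : A -> B, forall a a', f a = f a' -> a = a'.
Definition card_lt (A B : Type) : Prop := card_le A B /\ ~ card_le B A.

Record space : Type := Space {
  pt :> Type;
  open : (pt -> Prop) -> Prop;
  open_full : open (fun _ => True);
  open_inter : forall U V, open U -> open V -> open (fun x => U x /\ V x);
  open_union : forall F : (pt -> Prop) -> Prop,
      (forall U, F U -> open U) -> open (fun x => exists U, F U /\ U x)
}.

Arguments open {s} _.

Section Subspace.
Variables (X : space) (A : X -> Prop).
Definition sub_open (V : {x | A x} -> Prop) : Prop :=
  exists W : X -> Prop, open W /\ forall y, V y <-> W (proj1_sig y).

Lemma sub_open_full : sub_open (fun _ => True).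
Proof. exists (fun _ => True); split; [apply open_full | tauto]. Qed.

Lemma sub_open_inter U V : sub_open U -> sub_open V ->
  sub_open (fun x => U x /\ V x).
Proof.
  intros [W1 [H1 E1]] [W2 [H2 E2]].
  exists (fun x => W1 x /\ W2 x); split; [apply open_inter; auto|].
  intro y; rewrite E1, E2; tauto.
Qed.

Lemma sub_open_union (F : ({x | A x} -> Prop) -> Prop) :
  (forall U, F U -> sub_open U) -> sub_open (fun x => exists U, F U /\ U x).
Proof.
  intros HF.
  exists (fun x => exists W, (open W /\ exists U, F U /\
             forall y, U y <-> W (proj1_sig y)) /\ W x).
  split.
  - apply open_union. intros W [HW _]; exact HW.
  - intro y; split.
    + intros [U [FU Uy]]. destruct (HF U FU) as [W [HW EW]].
      exists W; split; [split; [exact HW | exists U; auto] | apply EW; exact Uy].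
    + intros [W [[HW [U [FU EU]]] Wy]]. exists U; split; [exact FU | apply EU; exact Wy].
Qed.

Definition subspace : space :=
  @Space {x | A x} sub_open sub_open_full sub_open_inter sub_open_union.
End Subspace.
Arguments subspace {X} A.

Definition continuous {X Y : space} (f : X -> Y) : Prop :=
  forall V : Y -> Prop, open V -> open (fun x => V (f x)).

Definition compact (X : space) : Prop :=
  forall F : (X -> Prop) -> Prop,
    (forall U, F U -> open U) -> (forall x, exists U, F U /\ U x) ->
    exists l : list (X -> Prop),
      (forall U, In U l -> F U) /\ (forall x, exists U, In U l /\ U x).

Definition hausdorff (X : space) : Prop :=
  forall x y : X, x <> y -> exists U V : X -> Prop,
    open U /\ open V /\ U x /\ V y /\ (forall z, ~ (U z /\ V z)).

Definition clopen {X : space} (U : X -> Prop) : Prop :=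
  open U /\ open (fun x => ~ U x).

Definition is_base {X : space} (B : (X -> Prop) -> Prop) : Prop :=
  (forall U, B U -> open U) /\
  (forall U, open U -> forall x, U x ->
     exists V, B V /\ V x /\ forall y, V y -> U y).

Definition zero_dim (X : space) : Prop := is_base (X:=X) (@clopen X).

Definition weight (X : space) (K : Type) : Prop :=
  (exists B, is_base B /\ card_le {U : X -> Prop | B U} K) /\
  (forall B, is_base B -> card_le K {U : X -> Prop | B U}).

Definition no_isolated_points (X : space) : Prop :=
  forall x : X, ~ open (fun y => y = x).

(* ---------- F_lambda and G_lambda ----------
   A cardinal lambda is represented by the predicate [small] on types:
   [small I] means |I| < lambda. *)

Definition type_lt (small : Type -> Prop) {X : space} (U : X -> Prop) : Prop :=
  exists (I : Type) (C : I -> X -> Prop),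
    small I /\ (forall i, clopen (C i)) /\ (forall x, U x <-> exists i, C i x).

Definition real_continuous {X : space} (f : X -> R) : Prop :=
  forall x eps, 0 < eps -> exists V : X -> Prop,
    open V /\ V x /\ forall y, V y -> Rabs (f y - f x) < eps.

Definition bounded (T : Type) (f : T -> R) : Prop :=
  exists M, forall t, Rabs (f t) <= M.

Definition Cstar_embedded {X : space} (U : X -> Prop) : Prop :=
  forall f : subspace U -> R,
    real_continuous f -> bounded f ->
    exists g : X -> R, real_continuous g /\ forall u, g (proj1_sig u) = f u.

Definition F_space (small : Type -> Prop) (X : space) : Prop :=
  zero_dim X /\
  forall U : X -> Prop, open U -> type_lt small U -> Cstar_embedded U.

Definition G_space (small : Type -> Prop) (X : space) : Prop :=
  forall (I : Type) (O : I -> X -> Prop), small I -> (forall i, open (O i)) ->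
    (exists x, forall i, O i x) ->
    exists W : X -> Prop, open W /\ (exists x, W x) /\
      forall x, W x -> forall i, O i x.

Definition parovicenko (small : Type -> Prop) (X : space) : Prop :=
  compact X /\ hausdorff X /\ zero_dim X /\
  F_space small X /\ G_space small X /\ no_isolated_points X.

Definition stone_cech {Y B : space} (e : Y -> B) : Prop :=
  compact B /\ hausdorff B /\
  (forall y y', e y = e y' -> y = y') /\ continuous e /\
  (forall U : Y -> Prop, open U ->
     exists W : B -> Prop, open W /\ forall y, U y <-> W (e y)) /\
  (forall W : B -> Prop, open W -> (exists b, W b) -> exists y, W (e y)) /\
  (forall (K : space) (f : Y -> K), compact K -> hausdorff K -> continuous f ->
     exists g : B -> K, continuous g /\ forall y, g (e y) = f y).

Definition remainder {Y B : space} (e : Y -> B) : space :=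
  subspace (fun b : B => ~ exists y, e y = b).

(* Main.v *)
(* Write [X = S \ {x}].  Modulo the clopen sets that miss a neighbourhood of [x], the clopen subsets of
   [X] are the clopen subsets of the remainder, so everything is a question about clopen subsets of [X].
   These are glued from pieces on [|K|] many clopen sets covering [X], taken in order type [|K|]: at each
   stage fewer than [|K|] pieces have been decided, and the F-property of [S] extends them.
   For families of length [|K|] one must avoid conflicts of earlier pieces with later requirements.
   Call [A] thin if [x] is not an accumulation point of any small (type less than [|K|]) part of [A].
   By the F-property a small set is, near [x], contained in or disjoint from each clopen subset of [X];
   hence of two almost disjoint ones at least one is thin.  Thin sets can be trimmed near [x] to avoid all
   earlier requirements, and the few non-thin ones can be absorbed.  This gives the F-property and the
   G-property of the remainder for [|K|] many sets; a tree of clopen sets of height [|K|] then yields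
   [2^|K|] disjoint open sets, which bounds the weight from below. *)
From Stdlib Require Import Reals List Lra Lia.
From Stdlib Require Import ClassicalEpsilon ProofIrrelevance FunctionalExtensionality PropExtensionality.
From mathcomp Require boolp wochoice.
Require Import Defs.
Set Bullet Behavior "Strict Subproofs".

(** * Well-orders and cardinals *)

(** [K_regular] acts through two consequences: [|K|] is a regular cardinal ([card_lt_sigma]), so
    what fewer than [|K|] stages have decided again has type less than [|K|]; and [K * K] injects
    into [K]. [B] is known only by its universal property, and the Stone-Cech compactification of a
    zero-dimensional space need not be zero-dimensional. It is shown to be so by separation inside
    the punctured space. There uncountable and countable [K] are treated apart, because a countable
    union of clopen sets has type less than [|K|] only in the first case. *)

Lemma set_ext (T : Type) (U V : T -> Prop) : (forall y, U y <-> V y) -> U = V.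
Proof.
  intro H; apply functional_extensionality; intro y.
  apply propositional_extensionality, H.
Qed.

Lemma sig_eq (T : Type) (P : T -> Prop) (u v : {t | P t}) :
  proj1_sig u = proj1_sig v -> u = v.
Proof.
  destruct u as [u hu], v as [v hv]; simpl; intros <-; f_equal; apply proof_irrelevance.
Qed.

Lemma choice_fun (A B : Type) (R : A -> B -> Prop) :
  (forall a, exists b, R a b) -> exists f : A -> B, forall a, R a (f a).
Proof.
  intro H; exists (fun a => proj1_sig (constructive_indefinite_description _ (H a))).
  intro a; exact (proj2_sig (constructive_indefinite_description _ (H a))).
Qed.

Lemma cond_choice (A B : Type) (P : A -> Prop) (R : A -> B -> Prop) (b0 : B) :
  (forall a, P a -> exists b, R a b) -> exists f : A -> B, forall a, P a -> R a (f a).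
Proof.
  intro H; apply choice_fun with (R := fun a b => P a -> R a b); intro a.
  destruct (classic (P a)) as [h|h].
  - destruct (H a h) as [b hb]; exists b; auto.
  - exists b0; tauto.
Qed.

Lemma card_le_trans (A B C : Type) : card_le A B -> card_le B C -> card_le A C.
Proof. intros [f hf] [g hg]; exists (fun a => g (f a)); auto. Qed.

Lemma card_le_of_cover (A B : Type) (R : A -> B -> Prop) :
  (forall b, exists a, R a b) -> (forall a b b', R a b -> R a b' -> b = b') ->
  card_le B A.
Proof.
  intros H1 H2; destruct (choice_fun _ _ (fun b a => R a b) H1) as [g hg].
  exists g; intros b b' e; apply (H2 (g b)); [apply hg | rewrite e; apply hg].
Qed.

(** [wochoice] provides a boolean relation in which every non-empty boolean predicate has a unique
    least element. [HM] carries this over to propositional predicates; least elements of sets of at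
    most three points then give the order axioms. *)
Lemma well_order_exists (T : Type) : exists lt : T -> T -> Prop,
  (forall a b c, lt a b -> lt b c -> lt a c) /\
  (forall a b, lt a b \/ a = b \/ lt b a) /\ well_founded lt.
Proof.
  destruct (@wochoice.well_ordering_principle (boolp.boolp_classicType__canonical__eqtype_Equality T))
    as [R HR].
  assert (HM : forall A : T -> Prop, (exists a, A a) -> exists z, A z /\
     (forall y, A y -> R z y = true) /\
     (forall z', A z' -> (forall y, A y -> R z' y = true) -> z = z')).
  { intros A [a ha].
    pose (A' := fun y : T => if excluded_middle_informative (A y) then true else false).
    assert (E : forall y, A' y = true <-> A y).
    { intro y; unfold A'; destruct (excluded_middle_informative (A y)); split; intro; auto; discriminate. }
    destruct (HR A' (ex_intro _ a (proj2 (E a) ha))) as [z [[h1 h2] h3]].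
    exists z; split; [apply E; exact h1|split].
    - intros y hy; apply (h2 y), E, hy.
    - intros z' hz' hl; apply h3; split; [apply E; exact hz'|].
      intros y hy; apply hl, E; exact hy. }
  assert (Rrefl : forall a, R a a = true).
  { intro a; destruct (HM (eq a)) as [z [<- [h _]]]; [exists a; auto | apply h; auto]. }
  assert (Rtot : forall a b, R a b = true \/ R b a = true).
  { intros a b; destruct (HM (fun y => y = a \/ y = b)) as [z [[-> | ->] [h _]]];
      [exists a; auto | left; apply h; auto | right; apply h; auto]. }
  assert (Ranti : forall a b, R a b = true -> R b a = true -> a = b).
  { intros a b h1 h2; destruct (HM (fun y => y = a \/ y = b)) as [z [_ [_ h]]]; [exists a; auto|].
    rewrite <- (h a), <- (h b); auto; intros y [-> | ->]; auto. }
  exists (fun a b => R b a <> true); split; [|split].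
  - intros a b c h1 h2 h3.
    destruct (HM (fun y => y = a \/ y = b \/ y = c)) as [z [hz [hl _]]]; [exists a; auto|].
    destruct hz as [-> | [-> | ->]].
    + apply h2. assert (a = c) as -> by (apply Ranti; auto).
      destruct (Rtot b c) as [h|h]; [exfalso|]; auto.
    + apply h1; auto.
    + apply h2; auto.
  - intros a b; destruct (classic (R a b = true)); destruct (classic (R b a = true)); auto.
  - intro a; apply NNPP; intro ha.
    destruct (HM (fun y => ~ Acc (fun a b => R b a <> true) y)) as [z [hz [hl _]]]; [exists a; auto|].
    apply hz; constructor; intros y hy; apply NNPP; intro hn; apply hy, hl, hn.
Qed.

Lemma wf_min (T : Type) (lt : T -> T -> Prop) (wf : well_founded lt) (P : T -> Prop) :
  (exists a, P a) -> exists a, P a /\ forall b, lt b a -> ~ P b.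
Proof.
  intros [a ha]; apply NNPP; intro hn; revert ha; induction (wf a) as [a _ IH]; intro ha.
  apply hn; exists a; split; auto.
Qed.

(** Predecessor values arrive as a function on a subtype, so the unfolding equation of [Fix] needs
    only functional extensionality. *)
Lemma wf_fix (T A : Type) (lt : T -> T -> Prop) (wf : well_founded lt)
  (F : forall k, ({j | lt j k} -> A) -> A) :
  exists f : T -> A, forall k, f k = F k (fun j => f (proj1_sig j)).
Proof.
  exists (Fix wf (fun _ => A) (fun k r => F k (fun j => r (proj1_sig j) (proj2_sig j)))).
  intro k; rewrite Fix_eq at 1; [reflexivity|].
  intros y f g E; f_equal; apply functional_extensionality; intros [j hj]; apply E.
Qed.

(* The order is pulled back from the shortest initial segment of a well-order that has cardinality |K|. *)
Lemma cardinal_well_order (K : Type) : exists lt : K -> K -> Prop,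
  (forall a b c, lt a b -> lt b c -> lt a c) /\
  (forall a b, lt a b \/ a = b \/ lt b a) /\ well_founded lt /\
  (forall k, card_lt {j | lt j k} K).
Proof.
  destruct (well_order_exists K) as [lt [htr [htot hwf]]].
  assert (hle : forall k, card_le {j | lt j k} K)
    by (intro k; exists (@proj1_sig _ _); apply sig_eq).
  destruct (classic (exists a, card_le K {j | lt j a})) as [hex|hno].
  - destruct (wf_min _ _ hwf _ hex) as [a [[f hf] hmin]].
    exists (fun j k => lt (proj1_sig (f j)) (proj1_sig (f k))); split; [|split; [|split]].
    + intros b c d; apply htr.
    + intros b c; destruct (htot (proj1_sig (f b)) (proj1_sig (f c))) as [h|[h|h]]; auto.
      right; left; apply hf, sig_eq, h.
    + intro b; assert (H : forall u, forall b, u = proj1_sig (f b) ->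
         Acc (fun j k => lt (proj1_sig (f j)) (proj1_sig (f k))) b).
      { intro u; induction (hwf u) as [u _ IH]; intros b' ->; constructor; intros c hc.
        apply (IH _ hc); reflexivity. }
      apply (H _ _ eq_refl).
    + intro k; split; [exists (@proj1_sig _ _); apply sig_eq|].
      intro h; apply (hmin (proj1_sig (f k))); [apply (proj2_sig (f k))|].
      apply (card_le_trans _ _ _ h).
      exists (fun j => exist (fun j => lt j (proj1_sig (f k))) (proj1_sig (f (proj1_sig j))) (proj2_sig j)).
      intros u v e; apply sig_eq, hf, sig_eq. exact (f_equal (@proj1_sig _ _) e).
  - exists lt; split; [exact htr|split; [exact htot|split; [exact hwf|]]].
    intro k; split; [apply hle|]; intro h; apply hno; eauto.
Qed.

Section SmallCardinals.
Variable K : Type.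
Hypothesis K_infinite : card_le nat K.
Hypothesis K_regular : forall L : Type, card_lt L K -> card_le (L -> K) K.

Lemma two_points : exists k k' : K, k <> k'.
Proof.
  destruct K_infinite as [f hf]; exists (f 0%nat), (f 1%nat); intro e.
  apply hf in e; discriminate.
Qed.

Lemma card_lt_of_le (I J : Type) : card_le I J -> card_lt J K -> card_lt I K.
Proof.
  intros h [h1 h2]; split; [exact (card_le_trans _ _ _ h h1)|].
  intro h'; apply h2, (card_le_trans _ _ _ h' h).
Qed.

Lemma card_lt_bool : card_lt bool K.
Proof.
  destruct two_points as [a [b hab]]; destruct K_infinite as [f hf']; split.
  - exists (fun c : bool => if c then a else b); intros [] []; congruence.
  - intros [g hg].
    assert (E : forall n m, g (f n) = g (f m) -> n = m) by auto.
    assert (H01 := E 0%nat 1%nat); assert (H02 := E 0%nat 2%nat); assert (H12 := E 1%nat 2%nat).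
    destruct (g (f 0%nat)), (g (f 1%nat)), (g (f 2%nat));
      first [discriminate (H01 eq_refl) | discriminate (H02 eq_refl) | discriminate (H12 eq_refl)].
Qed.

Lemma card_le_prod : card_le (K * K) K.
Proof.
  apply (fun h => card_le_trans _ _ _ h (K_regular bool card_lt_bool)).
  exists (fun p (c : bool) => if c then fst p else snd p); intros [a b] [a' b'] e.
  f_equal; [exact (f_equal (fun h => h true) e) | exact (f_equal (fun h => h false) e)].
Qed.
(* Koenig: a diagonal function [I -> K] avoids the fewer than |K| values taken on each J i. *)
Lemma card_lt_sigma (I : Type) (J : I -> Type) :
  card_lt I K -> (forall i, card_lt (J i) K) -> card_lt {i : I & J i} K.
Proof.
  intros hI hJ; destruct two_points as [k0 _].
  assert (hno : ~ card_le K {i : I & J i}).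
  { intro h.
    destruct (card_le_trans _ _ _ (K_regular I hI) h) as [phi hphi].
    assert (hi : forall i, exists k, forall f, projT1 (phi f) = i -> f i <> k).
    { intro i; apply NNPP; intro hn; apply (proj2 (hJ i)).
      apply card_le_of_cover with
        (R := fun (j : J i) k => exists f, phi f = existT _ i j /\ f i = k).
      - intro k; apply NNPP; intro hk; apply hn; exists k; intros f e1 e2.
        apply hk; destruct (phi f) as [i' j] eqn:E; simpl in e1; subst i'.
        exists j, f; auto.
      - intros j k k' [f [e1 e2]] [f' [e1' e2']].
        rewrite <- e1' in e1; apply hphi in e1; congruence. }
    destruct (choice_fun _ _ _ hi) as [d hd].
    apply (hd (projT1 (phi d)) d eq_refl eq_refl). }
  split; [|exact hno].
  assert (hf : forall i, exists f : J i -> K, forall a a', f a = f a' -> a = a')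
    by (intro i; apply (proj1 (hJ i))).
  apply (fun h => card_le_trans _ _ _ h card_le_prod).
  destruct hI as [[g hg] _].
  (* [choice_fun] is not dependent, so the injection of [J i] is extended to the whole sum, with the
     value [k0] off the fibre over [i]. *)
  destruct (choice_fun _ _ (fun i (f : {i : I & J i} -> K) =>
    forall a a', f (existT _ i a) = f (existT _ i a') -> a = a')) as [F hF].
  { intro i; destruct (hf i) as [f hf'].
    exists (fun p => match excluded_middle_informative (i = projT1 p) with
      | left e => f (eq_rect_r J (projT2 p) e) | right _ => k0 end).
    intros a a'; simpl; destruct (excluded_middle_informative (i = i)) as [e|]; [|tauto].
    rewrite (proof_irrelevance _ e eq_refl); apply hf'. }
  exists (fun p => (g (projT1 p), F (projT1 p) p)); intros [i a] [i' a'] e; simpl in e.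
  injection e as e1 e2; apply hg in e1; subst i'; apply hF in e2; congruence.
Qed.

End SmallCardinals.

(** * Topology *)

Lemma open_ext {X : space} (U V : X -> Prop) :
  open U -> (forall y, U y <-> V y) -> open V.
Proof. intros h e; rewrite <- (set_ext _ _ _ e); exact h. Qed.

Lemma open_local {X : space} (U : X -> Prop) :
  (forall y, U y -> exists V, open V /\ V y /\ forall z, V z -> U z) -> open U.
Proof.
  intro h; apply open_ext with (fun y => exists V, (open V /\ forall z, V z -> U z) /\ V y).
  - apply open_union; tauto.
  - intro y; split; [intros [V [[_ hV] hy]]; auto|].
    intro hy; destruct (h y hy) as [V hV]; exists V; tauto.
Qed.

Lemma open_false {X : space} : open (fun _ : X => False).
Proof. apply open_local; tauto. Qed.

Lemma open_ex {X : space} (I : Type) (U : I -> X -> Prop) :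
  (forall i, open (U i)) -> open (fun y => exists i, U i y).
Proof.
  intro h; apply open_local; intros y [i hi]; exists (U i); split; [auto|]; split; eauto.
Qed.

Lemma open_or {X : space} (U V : X -> Prop) :
  open U -> open V -> open (fun y => U y \/ V y).
Proof.
  intros hU hV; apply open_local; intros y [h|h]; [exists U | exists V]; auto.
Qed.

Lemma clopen_ext {X : space} (U V : X -> Prop) :
  clopen U -> (forall y, U y <-> V y) -> clopen V.
Proof. intros h e; rewrite <- (set_ext _ _ _ e); exact h. Qed.

Lemma clopen_false {X : space} : clopen (fun _ : X => False).
Proof.
  split; [apply open_false|]; apply open_ext with (fun _ : X => True); [apply open_full|tauto].
Qed.

Lemma clopen_not {X : space} (U : X -> Prop) : clopen U -> clopen (fun y => ~ U y).
Proof.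
  intros [h1 h2]; split; [exact h2|]; apply open_ext with U; [exact h1|].
  intro y; split; [tauto | apply NNPP].
Qed.

Lemma clopen_and {X : space} (U V : X -> Prop) :
  clopen U -> clopen V -> clopen (fun y => U y /\ V y).
Proof.
  intros [h1 h2] [h3 h4]; split; [apply open_inter; auto|].
  apply open_ext with (fun y => ~ U y \/ ~ V y); [apply open_or; auto|].
  intro y; split; [tauto|apply not_and_or].
Qed.

Lemma clopen_or {X : space} (U V : X -> Prop) :
  clopen U -> clopen V -> clopen (fun y => U y \/ V y).
Proof.
  intros hU hV.
  apply clopen_ext with (fun y => ~ (~ U y /\ ~ V y)).
  - apply clopen_not, clopen_and; apply clopen_not; auto.
  - intro y; split; [intro h; apply NNPP; tauto | tauto].
Qed.

Lemma clopen_list {X : space} (l : list (X -> Prop)) (P : (X -> Prop) -> Prop) :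
  (forall U, In U l -> clopen U) -> clopen (fun y => exists U, In U l /\ P U /\ U y).
Proof.
  induction l as [|U l IH]; intro h.
  - apply clopen_ext with (fun _ => False); [apply clopen_false|].
    intro y; split; [tauto|]; intros [U [[] _]].
  - assert (h' := IH (fun V hV => h V (or_intror hV))).
    destruct (classic (P U)) as [hP|hP].
    + apply clopen_ext with (fun y => U y \/ exists V, In V l /\ P V /\ V y).
      * apply clopen_or; [apply h; left|]; auto.
      * intro y; split.
        -- intros [hy|[V hV]]; [exists U; simpl; auto | exists V; simpl; tauto].
        -- intros [V [[<- |hl] hV]]; [left; tauto | right; exists V; auto].
    + apply (clopen_ext _ _ h'); intro y; split.
      * intros [V hV]; exists V; simpl; tauto.
      * intros [V [[<- |hl] hV]]; [tauto | exists V; auto].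
Qed.

(** The hypothesis makes the closures of [M] and [N] disjoint, though neither set need be closed.
    The union of those members of a finite subcover that miss [N] works: a member through a point of
    [M] cannot miss [M]. *)
Lemma compact_sep {X : space} (M N : X -> Prop) : compact X ->
  (forall y : X, exists V, clopen V /\ V y /\ ((forall z, V z -> ~ M z) \/ (forall z, V z -> ~ N z))) ->
  exists d : X -> Prop, clopen d /\ (forall y, M y -> d y) /\ (forall y, N y -> ~ d y).
Proof.
  intros hX h.
  destruct (hX (fun V => clopen V /\ ((forall z, V z -> ~ M z) \/ (forall z, V z -> ~ N z))))
    as [l [hl hc]].
  - intros V [[hV _] _]; exact hV.
  - intro y; destruct (h y) as [V hV]; exists V; tauto.
  - exists (fun y => exists V, In V l /\ (forall z, V z -> ~ N z) /\ V y); split; [|split].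
    + apply clopen_list; intros V hV; apply hl; auto.
    + intros y hy; destruct (hc y) as [V [hV hVy]]; exists V; split; [|split]; auto.
      destruct (hl V hV) as [_ [h1|h1]]; [destruct (h1 y hVy hy) | exact h1].
    + intros y hy [V [_ [h1 h2]]]; exact (h1 y h2 hy).
Qed.

Lemma compact_directed {X : space} (I : Type) (Z : I -> X -> Prop) :
  compact X -> inhabited I -> (forall i, open (fun y => ~ Z i y)) ->
  (forall i, exists y, Z i y) ->
  (forall i j, exists k, forall y, Z k y -> Z i y /\ Z j y) ->
  exists y, forall i, Z i y.
Proof.
  intros hX [i0] hZ hne hdir; apply NNPP; intro hn.
  destruct (hX (fun U => exists i, U = fun y => ~ Z i y)) as [l [hl hc]].
  - intros U [i ->]; auto.
  - intro y; apply NNPP; intro hy; apply hn; exists y; intro i; apply NNPP; intro hi.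
    apply hy; exists (fun y => ~ Z i y); split; [exists i|]; auto.
  - assert (H : forall l' : list (X -> Prop), (forall U, In U l' -> exists i, U = fun y => ~ Z i y) ->
      exists k, forall U, In U l' -> forall y, Z k y -> ~ U y).
    { induction l' as [|U l' IH]; intro h; [exists i0; intros U []|].
      destruct IH as [k hk]; [intros V hV; apply h; right; auto|].
      destruct (h U (or_introl eq_refl)) as [i ->].
      destruct (hdir i k) as [m hm]; exists m; intros V [<- |hV] y hy.
      - intro h1; apply h1, hm, hy.
      - apply (hk V hV), hm, hy. }
    destruct (H l hl) as [k hk]; destruct (hne k) as [y hy]; destruct (hc y) as [U [h1 h2]].
    exact (hk U h1 y hy h2).
Qed.

Definition separated {X : space} (A A' : X -> Prop) : Prop :=
  exists U V : X -> Prop, open U /\ open V /\ (forall y, A y -> U y) /\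
    (forall y, A' y -> V y) /\ (forall y, ~ (U y /\ V y)).

Lemma separated_sym {X : space} (A A' : X -> Prop) : separated A A' -> separated A' A.
Proof.
  intros [U [V [h1 [h2 [h3 [h4 h5]]]]]]; exists V, U; repeat split; auto.
  intros y [h h']; apply (h5 y); auto.
Qed.

Lemma separated_pointwise {X : space} (A A' : X -> Prop) : compact X ->
  open (fun y => ~ A' y) -> (forall y, A' y -> separated A (eq y)) -> separated A A'.
Proof.
  intros hX hA' h.
  destruct (hX (fun V => (open V /\ forall y, V y -> ~ A' y) \/
     (open V /\ exists U, open U /\ (forall y, A y -> U y) /\ forall y, ~ (U y /\ V y)))) as [l [hl hc]].
  - intros V [[hV _]|[hV _]]; exact hV.
  - intro y; destruct (classic (A' y)) as [hy|hy].
    + destruct (h y hy) as [U [V [h1 [h2 [h3 [h4 h5]]]]]].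
      exists V; split; [right; split; eauto | apply h4; reflexivity].
    + exists (fun y => ~ A' y); split; auto.
  - assert (H : forall l' : list (X -> Prop), (forall V, In V l' -> (open V /\ forall y, V y -> ~ A' y) \/
       (open V /\ exists U, open U /\ (forall y, A y -> U y) /\ forall y, ~ (U y /\ V y))) ->
       separated A (fun y => A' y /\ exists V, In V l' /\ V y)).
    { induction l' as [|V l' IH]; intro hl'.
      - exists (fun _ => True), (fun _ => False); repeat split; auto using open_full, open_false.
        + intros y [_ [V [[] _]]].
        + tauto.
      - destruct IH as [U' [V' [h1 [h2 [h3 [h4 h5]]]]]]; [intros W hW; apply hl'; right; auto|].
        destruct (hl' V (or_introl eq_refl)) as [[hV hV']|[hV [U [hU [hU1 hU2]]]]].
        + exists U', V'; repeat split; auto.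
          intros y [hy [W [[<- |hW] hWy]]]; [destruct (hV' y hWy hy) | apply h4; eauto].
        + exists (fun y => U y /\ U' y), (fun y => V y \/ V' y); repeat split; auto using open_inter, open_or.
          * intros y [hy [W [[<- |hW] hWy]]]; [left; auto | right; apply h4; eauto].
          * intros y [[a b] [c|c]]; [apply (hU2 y) | apply (h5 y)]; auto. }
    destruct (H l hl) as [U [V [h1 [h2 [h3 [h4 h5]]]]]]; exists U, V; repeat split; auto.
Qed.

Lemma compact_hausdorff_normal {X : space} (A A' : X -> Prop) : compact X -> hausdorff X ->
  open (fun y => ~ A y) -> open (fun y => ~ A' y) -> (forall y, ~ (A y /\ A' y)) -> separated A A'.
Proof.
  intros hX hH hA hA' hd; apply separated_pointwise; auto; intros y hy.
  apply separated_sym, separated_pointwise; auto; intros z hz.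
  destruct (hH y z) as [U [V [h1 [h2 [h3 [h4 h5]]]]]]; [intros <-; apply (hd y); auto|].
  exists U, V; repeat split; auto; intros w <-; auto.
Qed.

Lemma hausdorff_open_ne {X : space} (p : X) : hausdorff X -> open (fun y => y <> p).
Proof.
  intro hH; apply open_local; intros y hy.
  destruct (hH y p hy) as [U [V [h1 [h2 [h3 [h4 h5]]]]]]; exists U; split; [|split]; auto.
  intros z hz ->; apply (h5 p); auto.
Qed.

Lemma zero_dim_nbhd {X : space} (U : X -> Prop) (y : X) : zero_dim X -> open U -> U y ->
  exists V, clopen V /\ V y /\ forall z, V z -> U z.
Proof. intros [_ h] hU hy; apply h; auto. Qed.

(** Take a finite subcover by [U] and clopen sets missing [y]. The complements of the latter
    intersect in a clopen neighbourhood of [y], which only [U] is left to cover. *)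
Lemma zero_dim_of_points {X : space} : compact X ->
  (forall y z : X, y <> z -> exists V : X -> Prop, clopen V /\ V y /\ ~ V z) -> zero_dim X.
Proof.
  intros hX h; split; [intros U [hU _]; exact hU|]; intros U hU y hy.
  destruct (hX (fun V => V = U \/ (clopen V /\ ~ V y))) as [l [hl hc]].
  - intros V [-> |[[hV _] _]]; auto.
  - intro z; destruct (classic (y = z)) as [<- |hz]; [exists U; auto|].
    destruct (h y z hz) as [V [h1 [h2 h3]]]; exists (fun z => ~ V z); split; [right|]; auto.
    split; [apply clopen_not; auto | tauto].
  - assert (H : forall l' : list (X -> Prop), (forall V, In V l' -> V = U \/ (clopen V /\ ~ V y)) ->
      exists W : X -> Prop, clopen W /\ W y /\ forall z, W z -> (exists V, In V l' /\ V z) -> U z).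
    { induction l' as [|V l' IH]; intro hl'.
      - exists (fun y => ~ False); split; [apply clopen_not, clopen_false|]; split; [tauto|].
        intros z _ [V [[] _]].
      - destruct IH as [W [h1 [h2 h3]]]; [intros V' hV'; apply hl'; right; auto|].
        destruct (hl' V (or_introl eq_refl)) as [-> |[hV hVy]].
        + exists W; split; [|split]; auto; intros z hz [V' [[<- |hV'] hz']]; eauto.
        + exists (fun z => W z /\ ~ V z); split; [apply clopen_and; auto using clopen_not|].
          split; auto; intros z [hz hz1] [V' [[<- |hV'] hz']]; [tauto|eauto]. }
    destruct (H l hl) as [W [h1 [h2 h3]]]; exists W; split; [|split]; auto.
Qed.

Lemma compact_subspace {X : space} (A : X -> Prop) :
  compact X -> open (fun y => ~ A y) -> compact (subspace A).
Proof.
  intros hX hA F hF hc.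
  destruct (hX (fun W => open W /\ ((forall y, W y -> ~ A y) \/
      exists U, F U /\ forall y : subspace A, U y <-> W (proj1_sig y)))) as [l [hl hlc]].
  - tauto.
  - intro y; destruct (classic (A y)) as [hy|hy].
    + destruct (hc (exist _ y hy)) as [U [hU hUy]]; destruct (hF U hU) as [W [hW hWe]].
      exists W; split; [split; eauto|]; apply hWe in hUy; exact hUy.
    + exists (fun y => ~ A y); auto.
  - assert (H : forall l' : list (X -> Prop), (forall W, In W l' -> open W /\ ((forall y, W y -> ~ A y) \/
      exists U, F U /\ forall y : subspace A, U y <-> W (proj1_sig y))) ->
      exists m : list (subspace A -> Prop), (forall U, In U m -> F U) /\
       forall y : subspace A, (exists W, In W l' /\ W (proj1_sig y)) -> exists U, In U m /\ U y).
    { induction l' as [|W l' IH]; intro h; [exists nil; split; [intros U []|intros y [W [[] _]]]|].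
      destruct IH as [m [h1 h2]]; [intros V hV; apply h; right; auto|].
      destruct (h W (or_introl eq_refl)) as [_ [hW|[U [hU hUe]]]].
      - exists m; split; auto; intros y [V [[<- |hV] hy]]; [destruct (hW _ hy (proj2_sig y)) | eauto].
      - exists (U :: m); split; [intros V [<- |hV]; auto|].
        intros y [V [[<- |hV] hy]]; [exists U; split; [left; auto|apply hUe; auto]|].
        destruct (h2 y) as [U' hU']; [eauto|]; exists U'; simpl; tauto. }
    destruct (H l hl) as [m [h1 h2]]; exists m; split; auto; intro y; apply h2, hlc.
Qed.

Lemma hausdorff_subspace {X : space} (A : X -> Prop) : hausdorff X -> hausdorff (subspace A).
Proof.
  intros hH y z hyz.
  destruct (hH (proj1_sig y) (proj1_sig z)) as [U [V [h1 [h2 [h3 [h4 h5]]]]]].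
  - intro e; apply hyz, sig_eq, e.
  - exists (fun y => U (proj1_sig y)), (fun y => V (proj1_sig y)).
    split; [exists U; split; [auto|tauto]|]; split; [exists V; split; [auto|tauto]|].
    split; [auto|]; split; [auto|]; intros w; apply h5.
Qed.

Lemma open_subspace_restrict {X : space} (A U : X -> Prop) :
  open U -> open (fun y : subspace A => U (proj1_sig y)).
Proof. intro h; exists U; split; [exact h|tauto]. Qed.

Lemma clopen_subspace_restrict {X : space} (A U : X -> Prop) :
  clopen U -> clopen (fun y : subspace A => U (proj1_sig y)).
Proof.
  intros [h1 h2]; split; [apply open_subspace_restrict; auto|].
  exact (open_subspace_restrict A _ h2).
Qed.

Lemma zero_dim_subspace {X : space} (A : X -> Prop) : zero_dim X -> zero_dim (subspace A).
Proof.
  intro h; split; [intros U [hU _]; exact hU|]; intros U [W [hW hWe]] y hy.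
  destruct (zero_dim_nbhd W (proj1_sig y) h hW) as [V [h1 [h2 h3]]]; [apply hWe, hy|].
  exists (fun y => V (proj1_sig y)); split; [apply clopen_subspace_restrict; auto|]; split; auto.
  intros z hz; apply hWe; auto.
Qed.

Lemma clopen_split {X : space} (e : X -> Prop) : zero_dim X -> hausdorff X -> no_isolated_points X ->
  clopen e -> (exists y, e y) ->
  exists d, clopen d /\ (exists y, e y /\ d y) /\ (exists y, e y /\ ~ d y).
Proof.
  intros hX hH hp he [y hy].
  assert (hz : exists z, e z /\ z <> y).
  { apply NNPP; intro hn; apply (hp y); apply (open_ext e); [apply he|].
    intro z; split; [intro h; apply NNPP; eauto | intros ->; auto]. }
  destruct hz as [z [hz hzy]].
  destruct (zero_dim_nbhd (fun w => w <> z) y hX) as [d [h1 [h2 h3]]]; auto using hausdorff_open_ne.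
  exists d; split; auto; split; eauto; exists z; split; auto; intro h; apply (h3 z); auto.
Qed.

(** * C*-embedding from clopen separation of disjoint sets *)

Section CstarEmbedding.
Variable K : Type.
Hypothesis K_infinite : card_le nat K.
Hypothesis K_square : card_le (K * K) K.
Variable X : space.
Hypothesis X_compact : compact X.
Hypothesis X_zero_dim : zero_dim X.
Notation type_le := (type_lt (fun I : Type => card_le I K)).
Variable U : X -> Prop.
Hypothesis U_type : type_le U.

(** On a clopen piece [C i], continuity keeps the part where [f <= -1/(n+1)] away from the
    complement of the set [f < 0], so a clopen set lies between. These clopen sets, over all pairs
    [(i, n)], exhaust [f < 0]. *)
Lemma sublevel_type_le (f : subspace U -> R) : real_continuous f ->
  type_le (fun y => exists h : U y, f (exist _ y h) < 0).
Proof.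
  intro hf; destruct U_type as [I [C [hI [hC e]]]].
  assert (hd : forall p : I * nat, exists d, clopen d /\
    (forall y h, C (fst p) y -> f (exist _ y h) <= - / (INR (snd p) + 1) -> d y) /\
    (forall y, d y -> exists h : U y, f (exist _ y h) < 0)).
  { intros [i n]; simpl.
    assert (hn : 0 < / (INR n + 1)) by (apply Rinv_0_lt_compat; pose proof (pos_INR n); lra).
    destruct (compact_sep (fun y => C i y /\ exists h, f (exist _ y h) <= - / (INR n + 1))
      (fun y => ~ exists h : U y, f (exist _ y h) < 0) X_compact) as [d [h1 [h2 h3]]].
    - intro y; destruct (classic (C i y)) as [hy|hy].
      + assert (hU : U y) by (apply e; eauto).
        assert (key : forall eps, 0 < eps -> exists V : X -> Prop, clopen V /\ V y /\
          forall z h, V z -> Rabs (f (exist _ z h) - f (exist _ y hU)) < eps).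
        { intros eps heps; destruct (hf (exist _ y hU) eps heps) as [V [[W [hW hWe]] [h1 h2]]].
          destruct (zero_dim_nbhd W y X_zero_dim hW) as [V' [h3 [h4 h5]]]; [apply (hWe (exist _ y hU)); auto|].
          exists V'; split; [|split]; auto; intros z h hz; apply h2, hWe, h5, hz. }
        destruct (Rlt_dec (f (exist _ y hU)) 0) as [h|h].
        * destruct (key (- f (exist _ y hU))) as [V [h1 [h2 h3]]]; [lra|].
          exists (fun z => V z /\ C i z); split; [apply clopen_and; auto|]; split; auto.
          right; intros z [h4 h5] h6; apply h6.
          assert (hz : U z) by (apply e; eauto).
          exists hz; specialize (h3 z hz h4); apply Rabs_def2 in h3; lra.
        * destruct (key (/ (INR n + 1)) hn) as [V [h1 [h2 h3]]].
          exists V; split; [|split]; auto; left; intros z h4 [_ [h5 h6]].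
          specialize (h3 z h5 h4); apply Rabs_def2 in h3; lra.
      + exists (fun z => ~ C i z); split; [apply clopen_not; auto|]; split; auto; left; tauto.
    - exists d; split; auto; split.
      + intros y h h4 h5; apply h2; split; eauto.
      + intros y hy; apply NNPP; intro h; apply (h3 y h hy). }
  apply choice_fun in hd; destruct hd as [d hd].
  exists (I * nat)%type, d; split; [|split].
  - apply card_le_trans with (K * K)%type; auto.
    destruct hI as [g hg], K_infinite as [g' hg'].
    exists (fun p => (g (fst p), g' (snd p))); intros [i n] [i' n'] h; injection h as h1 h2.
    apply hg in h1; apply hg' in h2; simpl in *; congruence.
  - intro p; apply hd.
  - intro y; split.
    + intros [h hy]; destruct (proj1 (e y) h) as [i hi].

      destruct (INR_unbounded (/ (- f (exist _ y h)))) as [n hn].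
      exists (i, n); apply (proj1 (proj2 (hd (i, n)))) with h; auto; simpl.
      assert (h1 : 0 < - f (exist _ y h)) by lra.
      assert (h2 : / (INR n + 1) <= - f (exist _ y h)); [|lra].
      rewrite <- (Rinv_inv (- f (exist _ y h))); apply Rinv_le_contravar; [apply Rinv_0_lt_compat; lra|lra].
    + intros [p hp]; apply hd in hp; exact hp.
Qed.

Hypothesis disjoint_sep : forall M N : X -> Prop, type_le M -> type_le N ->
  (forall y, ~ (M y /\ N y)) ->
  exists d : X -> Prop, clopen d /\ (forall y, M y -> d y) /\ (forall y, N y -> ~ d y).

(** The value is -1 on [d] because [d] will contain the set where the function is negative. *)
Definition sgn (d : X -> Prop) (y : X) : R := if excluded_middle_informative (d y) then -1 else 1.

Lemma sgn_continuous (d : X -> Prop) (y : X) : clopen d ->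
  exists V, open V /\ V y /\ forall z, V z -> sgn d z = sgn d y.
Proof.
  intros [h1 h2]; unfold sgn; destruct (excluded_middle_informative (d y)) as [h|h].
  - exists d; split; [|split]; auto; intros z hz; destruct excluded_middle_informative; tauto.
  - exists (fun z => ~ d z); split; [|split]; auto; intros z hz; destruct excluded_middle_informative; tauto.
Qed.

Lemma real_continuous_minus_sgn (f : subspace U -> R) (d : X -> Prop) (r : R) :
  real_continuous f -> clopen d ->
  real_continuous (fun u : subspace U => f u - r * sgn d (proj1_sig u)).
Proof.
  intros hf hd u eps heps; destruct (hf u eps heps) as [V [h1 [h2 h3]]].
  destruct (sgn_continuous d (proj1_sig u) hd) as [W [h4 [h5 h6]]].
  exists (fun v => V v /\ W (proj1_sig v)); split; [apply open_inter; auto; apply open_subspace_restrict; auto|].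
  split; auto; intros v [h7 h8]; rewrite (h6 _ h8).
  replace (f v - r * sgn d (proj1_sig u) - (f u - r * sgn d (proj1_sig u))) with (f v - f u) by ring; auto.
Qed.

(* Subtracting [-M/2] on a clopen set containing [f < 0] and [M/2] off it halves a bound [M] of [|f|];
   the corrections sum to the extension. *)
Lemma Cstar_embedded_of_sep : Cstar_embedded U.
Proof.
  intros f hf [M hM].
  destruct (cond_choice (subspace U -> R) (X -> Prop) real_continuous (fun f d => clopen d /\
    (forall u, f u < 0 -> d (proj1_sig u)) /\ (forall u, 0 < f u -> ~ d (proj1_sig u))) (fun _ => True)) as [sep hsep].
  { intros h hh.
    assert (hh' : real_continuous (fun u => - h u)).
    { intros u eps heps; destruct (hh u eps heps) as [V [h1 [h2 h3]]]; exists V; split; [|split]; auto.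
      intros v hv; replace (- h v - - h u) with (- (h v - h u)) by ring; rewrite Rabs_Ropp; auto. }
    destruct (disjoint_sep _ _ (sublevel_type_le h hh) (sublevel_type_le _ hh')) as [d [h1 [h2 h3]]].
    - intros y [[h1 h2] [h3 h4]]; rewrite (proof_irrelevance _ h3 h1) in h4; lra.
    - exists d; split; auto; split; intros [y hy] hu; [apply h2|apply h3]; exists hy; simpl; lra. }
  (* [F n] is what is left of [f] after [n] corrections and [G n] is the sum of these corrections,
     defined on all of [X]; thus [f = F n + G n] on [U]. *)
  pose (step := fun (h : subspace U -> R) (n : nat) (u : subspace U) => h u - M / 2 ^ (n + 1) * sgn (sep h) (proj1_sig u)).
  pose (F := fix F (n : nat) : subspace U -> R := match n with O => f | Datatypes.S n => step (F n) n end).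
  pose (G := fix G (n : nat) (y : X) : R := match n with O => 0 | Datatypes.S n => G n y + M / 2 ^ (n + 1) * sgn (sep (F n)) y end).
  assert (hF : forall n, real_continuous (F n)).
  { induction n as [|n IH]; auto; apply (real_continuous_minus_sgn (F n)); auto; apply hsep; auto. }
  assert (h2 : forall n, 0 < 2 ^ n) by (intro n; apply pow_lt; lra).
  assert (hpow : forall n, M / 2 ^ n = 2 * (M / 2 ^ (n + 1))).
  { intro n; rewrite Nat.add_1_r; simpl; field; apply Rgt_not_eq, h2. }
  assert (hFb : forall n u, Rabs (F n u) <= M / 2 ^ n).
  { induction n as [|n IH]; intro u; [simpl; rewrite Rdiv_1_r; auto|].
    specialize (IH u); specialize (hpow n); rewrite Nat.add_1_r in hpow.
    destruct (hsep (F n) (hF n)) as [_ [h3 h4]]; specialize (h3 u); specialize (h4 u).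
    change (F (Datatypes.S n) u) with (F n u - M / 2 ^ (n + 1) * sgn (sep (F n)) (proj1_sig u)).
    rewrite Nat.add_1_r; apply Rabs_le; unfold sgn; destruct excluded_middle_informative as [h|h].
    - assert (F n u <= 0) by (apply Rnot_lt_le; intro h'; exact (h4 h' h)).
      rewrite Rabs_left1 in IH by auto; lra.
    - assert (0 <= F n u) by (apply Rnot_lt_le; intro h'; exact (h (h3 h'))).
      rewrite Rabs_right in IH by lra; lra. }
  assert (hFG : forall n u, F n u = f u - G n (proj1_sig u)).
  { induction n as [|n IH]; intro u; simpl; [ring|]; unfold step; rewrite IH; ring. }
  destruct (classic (exists u0 : subspace U, True)) as [[u0 _]|hempty].
  (* If [U] is empty, the bound [M] may be negative. *)
  2:{ exists (fun _ => 0); split; [|intro u; destruct hempty; eauto].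
      intros y eps heps; exists (fun _ => True); split; [apply open_full|]; split; auto.
      intros; rewrite Rminus_diag, Rabs_R0; auto. }
  assert (hM0 : 0 <= M) by (apply Rle_trans with (2 := hM u0); apply Rabs_pos).
  assert (hMn : forall n, 0 <= M / 2 ^ n).
  { intro n; apply Rmult_le_pos; auto; apply Rlt_le, Rinv_0_lt_compat; auto. }
  assert (hsg : forall d y, -1 <= sgn d y <= 1).
  { intros d y; unfold sgn; destruct excluded_middle_informative; lra. }
  (* The right side is the exact geometric sum of the bounds of the corrections between [n] and
     [n + m]. *)
  assert (hGd : forall n m y, Rabs (G (n + m)%nat y - G n y) <= M / 2 ^ n - M / 2 ^ (n + m)).
  { intros n m y; induction m as [|m IH].
    - rewrite Nat.add_0_r, !Rminus_diag, Rabs_R0; lra.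
    - rewrite Nat.add_succ_r; simpl G.
      specialize (hpow (n + m)%nat); rewrite Nat.add_1_r in *.
      specialize (hMn (Datatypes.S (n + m))); specialize (hsg (sep (F (n + m)%nat)) y).
      assert (Rabs (M / 2 ^ Datatypes.S (n + m) * sgn (sep (F (n + m)%nat)) y) <= M / 2 ^ Datatypes.S (n + m)).
      { apply Rabs_le; nra. }
      replace (G (n + m)%nat y + M / 2 ^ Datatypes.S (n + m) * sgn (sep (F (n + m)%nat)) y - G n y)
        with ((G (n + m)%nat y - G n y) + M / 2 ^ Datatypes.S (n + m) * sgn (sep (F (n + m)%nat)) y) by ring.
      eapply Rle_trans; [apply Rabs_triang|]; lra. }
  assert (hsmall : forall eps, 0 < eps -> exists n, M / 2 ^ n < eps).
  (* The divisor is [M + 1] because [M] can be 0. *)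
  { intros eps heps; destruct (pow_lt_1_zero (/ 2)) with (y := eps / (M + 1)) as [n hn].
    - rewrite Rabs_right; lra.
    - apply Rdiv_lt_0_compat; lra.
    - exists n; specialize (hn n (le_n n)); rewrite pow_inv in hn.
      rewrite Rabs_right in hn by (apply Rle_ge, Rlt_le, Rinv_0_lt_compat; auto).
      apply Rmult_lt_compat_r with (r := M + 1) in hn; [|lra].
      replace (eps / (M + 1) * (M + 1)) with eps in hn by (field; lra).
      assert (0 < / 2 ^ n) by (apply Rinv_0_lt_compat; auto); unfold Rdiv; nra. }
  assert (hlim : forall y, exists l, forall n, Rabs (l - G n y) <= M / 2 ^ n).
  { intro y; destruct (R_complete (fun n => G n y)) as [l hl].
    - intros eps heps; destruct (hsmall (eps / 2)) as [N hN]; [lra|].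
      exists N; intros n m hn hm; unfold Rdist.
      replace n with (N + (n - N))%nat by lia; replace m with (N + (m - N))%nat by lia.
      assert (A := hGd N (n - N)%nat y); assert (A' := hGd N (m - N)%nat y).
      assert (D := hMn (N + (n - N))%nat); assert (D' := hMn (N + (m - N))%nat).
      replace (G (N + (n - N))%nat y - G (N + (m - N))%nat y)
        with ((G (N + (n - N))%nat y - G N y) + - (G (N + (m - N))%nat y - G N y)) by ring.
      eapply Rle_lt_trans; [apply Rabs_triang|]; rewrite Rabs_Ropp; lra.
    - exists l; intro n; apply Rnot_lt_le; intro h.
      destruct (hl (Rabs (l - G n y) - M / 2 ^ n)) as [N hN]; [lra|].
      specialize (hN (n + N)%nat ltac:(lia)); unfold Rdist in hN.
      assert (A := hGd n N y); assert (D := hMn (n + N)%nat).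
      replace (l - G n y) with (- (G (n + N)%nat y - l) + (G (n + N)%nat y - G n y)) in * by ring.
      assert (T := Rabs_triang (- (G (n + N)%nat y - l)) (G (n + N)%nat y - G n y)).
      rewrite Rabs_Ropp in T; lra. }
  apply choice_fun in hlim; destruct hlim as [g hg].
  exists g; split.
  - intros y eps heps; destruct (hsmall (eps / 2)) as [n hn]; [lra|].
    (* Each [G n] is a finite combination of clopen step functions, hence locally constant; the
       uniform limit [g] is therefore continuous. *)
    assert (hGl : forall n, exists V, open V /\ V y /\ forall z, V z -> G n z = G n y).
    { induction n0 as [|m IH]; [exists (fun _ => True); split; [apply open_full|]; auto|].
      destruct IH as [V [h3 [h4 h5]]]; destruct (sgn_continuous (sep (F m)) y) as [W [h6 [h7 h8]]]; [apply hsep; auto|].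
      exists (fun z => V z /\ W z); split; [apply open_inter; auto|]; split; auto.
      intros z [hz hz']; simpl; rewrite h5, h8; auto. }
    destruct (hGl n) as [V [h3 [h4 h5]]]; exists V; split; [|split]; auto; intros z hz.
    assert (A := hg y n); assert (A' := hg z n); rewrite (h5 z hz) in A'.
    replace (g z - g y) with ((g z - G n y) + - (g y - G n y)) by ring.
    eapply Rle_lt_trans; [apply Rabs_triang|]; rewrite Rabs_Ropp; lra.
  - intro u; apply NNPP; intro h.
    destruct (hsmall (Rabs (g (proj1_sig u) - f u) / 2)) as [n hn].
    + assert (0 < Rabs (g (proj1_sig u) - f u)) by (apply Rabs_pos_lt; lra); lra.
    + assert (A := hg (proj1_sig u) n); assert (A' := hFb n u); rewrite hFG in A'.
      replace (g (proj1_sig u) - f u) with ((g (proj1_sig u) - G n (proj1_sig u)) + - (f u - G n (proj1_sig u))) in hn by ring.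
      assert (T := Rabs_triang (g (proj1_sig u) - G n (proj1_sig u)) (- (f u - G n (proj1_sig u)))).
      rewrite Rabs_Ropp in T; lra.
Qed.
End CstarEmbedding.

(** [T f k] is one half of a clopen set inside all earlier [T f j], the half being chosen by [f k];
    so it depends only on the values of [f] up to [k]. Compactness gives the nested sets along a
    branch a common point, and the G-property then an interior. Branches that first differ at [k]
    enter complementary halves of the same set. *)
Lemma tree_of_open_sets (K : Type) (lt : K -> K -> Prop) (Y : space) (y0 : Y) :
  (forall a b c, lt a b -> lt b c -> lt a c) -> (forall a b, lt a b \/ a = b \/ lt b a) -> well_founded lt ->
  compact Y -> hausdorff Y -> zero_dim Y -> no_isolated_points Y -> G_space (fun I : Type => card_le I K) Y ->
  exists O : (K -> bool) -> Y -> Prop, (forall f, open (O f) /\ exists y, O f y) /\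
    forall f g y, O f y -> O g y -> f = g.
Proof.
  intros htr htot hwf hc hH hz hp hG.
  pose (ok := fun E : Y -> Prop => clopen E /\ exists y, E y).
  destruct (cond_choice (Y -> Prop) (Y -> Prop) (fun W => exists E, ok E /\ forall y, E y -> W y)
    (fun W E => ok E /\ forall y, E y -> W y) (fun _ => True)) as [inn hinn]; [auto|].
  destruct (cond_choice (Y -> Prop) (Y -> Prop) ok (fun E d => clopen d /\ (exists y, E y /\ d y) /\
    (exists y, E y /\ ~ d y)) (fun _ => True)) as [spl hspl].
  { intros E [h1 h2]; apply clopen_split; auto. }
  pose (step := fun (b : bool) (W : Y -> Prop) (y : Y) =>
    inn W y /\ if b then spl (inn W) y else ~ spl (inn W) y).
  assert (hT : exists T : (K -> bool) -> K -> Y -> Prop, forall f k,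
    T f k = step (f k) (fun y => forall j, lt j k -> T f j y)).
  { apply choice_fun with (R := fun f (Tf : K -> Y -> Prop) => forall k,
      Tf k = step (f k) (fun y => forall j, lt j k -> Tf j y)); intro f.
    destruct (wf_fix K (Y -> Prop) lt hwf (fun k r => step (f k) (fun y => forall j, r j y))) as [T hT].
    exists T; intro k; rewrite hT at 1; f_equal; apply set_ext; intro y; split.
    - intros h j hj; apply (h (exist _ j hj)).
    - intros h [j hj]; apply h; auto. }
  destruct hT as [T hT].
  assert (hstep : forall b W, (exists E, ok E /\ forall y, E y -> W y) ->
    ok (step b W) /\ forall y, step b W y -> W y).
  { intros b W h; destruct (hinn W h) as [h1 h2]; destruct (hspl _ h1) as [h3 [h4 h5]].
    unfold step; destruct b; (split; [split|intros y [h6 _]; auto]); auto.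
    - apply clopen_and; auto; apply h1.
    - apply clopen_and; [apply h1|apply clopen_not; auto]. }
  assert (hinter : forall f (I : Type) (k : I -> K), card_le I K -> inhabited I ->
    (forall i, ok (T f (k i)) /\ forall j y, lt j (k i) -> T f (k i) y -> T f j y) ->
    exists W, open W /\ (exists y, W y) /\ forall y, W y -> forall i, T f (k i) y).
  { intros f I k hI hi h; apply hG; auto; [intro i; apply h|].
    apply compact_directed; auto; [intro i; apply h|intro i; apply h|].
    intros i j; destruct (htot (k i) (k j)) as [h1|[h1|h1]].
    - exists j; intros y hy; split; auto; apply (proj2 (h j)); auto.
    - exists j; intros y hy; rewrite h1; auto.
    - exists i; intros y hy; split; auto; apply (proj2 (h i)); auto. }
  assert (main : forall f k, ok (T f k) /\ forall j y, lt j k -> T f k y -> T f j y).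
  { intros f k; induction (hwf k) as [k _ IH]; rewrite hT.
    destruct (hstep (f k) (fun y => forall j, lt j k -> T f j y)) as [h1 h2]; [|split; auto].
    destruct (classic (exists j, lt j k)) as [[j hj]|hno].
    - destruct (hinter f {j | lt j k} (@proj1_sig _ _)) as [W [h1 [[y h2] h3]]].
      + exists (@proj1_sig _ _); apply sig_eq.
      + constructor; exists j; auto.
      + intros [i hi]; apply IH; auto.
      + destruct (zero_dim_nbhd W y hz h1 h2) as [E [h4 [h5 h6]]]; exists E; split; [split; eauto|].
        intros z hz' i hi; apply (h3 z (h6 z hz') (exist _ i hi)).
    - exists (fun _ => ~ False); split; [split; [apply clopen_not, clopen_false|exists y0; tauto]|].
      intros y _ j hj; destruct hno; eauto. }
  destruct (classic (inhabited K)) as [hK|hK].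
  (* For empty [K] there is nothing to intersect; [K -> bool] then has a single element and the
     whole space serves. *)
  2:{ exists (fun _ _ => True); split.
      - intro f; split; [apply open_full|exists y0; auto].
      - intros f g _ _ _; apply functional_extensionality; intro k; destruct hK; constructor; auto. }
  destruct (choice_fun _ _ (fun f (W : Y -> Prop) => open W /\ (exists y, W y) /\ forall y, W y -> forall k, T f k y)) as [O hO].
  { intro f; apply (hinter f K (fun k => k)); auto; exists (fun k => k); auto. }
  exists O; split; [intro f; split; apply hO|].
  intros f g y hf hg; apply NNPP; intro hne.
  assert (hk : exists k, f k <> g k).
  { apply NNPP; intro h; apply hne, functional_extensionality; intro k; apply NNPP; eauto. }
  destruct (wf_min _ _ hwf _ hk) as [k [h1 h2]].
  assert (heq : forall j, lt j k -> T f j = T g j).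
  { intro j; induction (hwf j) as [j _ IH]; intro hj; rewrite (hT f), (hT g).
    assert (f j = g j) as -> by (apply NNPP; auto); f_equal; apply set_ext; intro z; split.
    - intros h i hi; rewrite <- IH; eauto.
    - intros h i hi; rewrite IH; eauto. }
  assert (hf' := proj2 (proj2 (hO f)) y hf k); assert (hg' := proj2 (proj2 (hO g)) y hg k).
  rewrite hT in hf', hg'.
  assert (hW : (fun y => forall j, lt j k -> T f j y) = (fun y => forall j, lt j k -> T g j y)).
  { apply set_ext; intro z; split; intros h i hi; [rewrite <- heq|rewrite heq]; auto. }
  rewrite hW in hf'; unfold step in hf', hg'; destruct (f k), (g k); tauto.
Qed.

(** * Clopen subsets of a punctured space *)

Section PuncturedSpace.
Variable K : Type.
Hypothesis K_infinite : card_le nat K.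
Hypothesis K_regular : forall L : Type, card_lt L K -> card_le (L -> K) K.
Variable lt : K -> K -> Prop.
Hypothesis lt_trans : forall a b c, lt a b -> lt b c -> lt a c.
Hypothesis lt_total : forall a b, lt a b \/ a = b \/ lt b a.
Hypothesis lt_wf : well_founded lt.
Hypothesis lt_seg : forall k, card_lt {j | lt j k} K.

Notation small := (fun I : Type => card_lt I K).
Notation le j k := (j = k \/ lt j k).

Lemma small_unit : card_lt unit K.
Proof.
  apply card_lt_of_le with bool; [|apply card_lt_bool; auto].
  exists (fun _ => true); intros [] []; reflexivity.
Qed.

Lemma small_seg_le (k : K) : card_lt {j | le j k} K.
Proof.
  apply card_lt_of_le with {b : bool & if b then {j | lt j k} else unit}.
  - apply card_le_of_cover with (R := fun (p : {b : bool & if b then {j | lt j k} else unit}) (j : {j | le j k}) =>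
      match p with
      | existT true i => proj1_sig i = proj1_sig j
      | existT false _ => proj1_sig j = k
      end).
    + intros [j [-> |h]].
      * exists (existT (fun b : bool => if b then {j | lt j k} else unit) false tt); reflexivity.
      * exists (existT (fun b : bool => if b then {j | lt j k} else unit) true (exist _ j h)); reflexivity.
    + intros [[] i] j j' e e'; apply sig_eq; congruence.
  - apply card_lt_sigma; auto; [apply card_lt_bool; auto|]; intros []; auto using small_unit.
Qed.

Lemma no_max (k : K) : exists m, lt k m.
Proof.
  apply NNPP; intro h; apply (proj2 (small_seg_le k)).
  assert (H : forall m, le m k).
  { intro m; destruct (lt_total m k) as [|[|]]; auto; destruct h; eauto. }
  exists (fun m => exist _ m (H m)); intros a b e; exact (f_equal (@proj1_sig _ _) e).
Qed.

Lemma not_lt_le (a b : K) : ~ lt a b -> le b a.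
Proof. intro h; destruct (lt_total a b) as [|[|]]; auto; tauto. Qed.

Lemma le_lt_trans (a b c : K) : le a b -> lt b c -> lt a c.
Proof. intros [-> |h]; eauto. Qed.

Lemma le_trans (a b c : K) : le a b -> le b c -> le a c.
Proof. intros [-> |h] [-> |h']; eauto. Qed.

Lemma le_total (a b : K) : le a b \/ le b a.
Proof. destruct (lt_total a b) as [|[|]]; auto. Qed.

(** * Sets of type less than [|K|] *)

Section Types.
Context {X : space}.
Implicit Types U V : X -> Prop.

Lemma type_lt_open U : type_lt small U -> open U.
Proof.
  intros [I [C [_ [hC e]]]]; apply open_ext with (fun y => exists i, C i y).
  - apply open_ex; intro i; apply hC.
  - intro y; symmetry; apply e.
Qed.

Lemma type_lt_ext U V : type_lt small U -> (forall y, U y <-> V y) -> type_lt small V.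
Proof. intros h e; rewrite <- (set_ext _ _ _ e); exact h. Qed.

Lemma type_lt_clopen U : clopen U -> type_lt small U.
Proof.
  intro h; exists unit, (fun _ => U); split; [apply small_unit|]; split; [auto|].
  intro y; split; [exists tt; auto | intros [_ h']; auto].
Qed.

Lemma type_lt_ex (I : Type) (U : I -> X -> Prop) :
  card_lt I K -> (forall i, type_lt small (U i)) -> type_lt small (fun y => exists i, U i y).
Proof.
  intros hI h.
  destruct (choice_fun I {J : Type & J -> X -> Prop} (fun i p => card_lt (projT1 p) K /\
     (forall j, clopen (projT2 p j)) /\ forall y, U i y <-> exists j, projT2 p j y)) as [F hF].
  { intro i; destruct (h i) as [J [C hC]]; exists (existT _ J C); exact hC. }
  exists {i : I & projT1 (F i)}, (fun p => projT2 (F (projT1 p)) (projT2 p)); split; [|split].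
  - apply card_lt_sigma; auto; intro i; apply hF.
  - intros [i j]; apply hF.
  - intro y; split.
    + intros [i hi]; apply hF in hi; destruct hi as [j hj].
      exists (existT (fun i => projT1 (F i)) i j); exact hj.
    + intros [[i j] hj]; exists i; apply hF; exists j; exact hj.
Qed.

Lemma type_lt_or U V : type_lt small U -> type_lt small V -> type_lt small (fun y => U y \/ V y).
Proof.
  intros hU hV; apply type_lt_ext with (fun y => exists b : bool, (if b then U else V) y).
  - apply type_lt_ex; [apply card_lt_bool; auto|]; intros []; auto.
  - intro y; split; [intros [[] h]; auto|].
    intros [h|h]; [exists true | exists false]; auto.
Qed.

Lemma type_lt_seg_le (k : K) (U : K -> X -> Prop) : (forall j, le j k -> type_lt small (U j)) ->
  type_lt small (fun y => exists j, le j k /\ U j y).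
Proof.
  intro h; apply type_lt_ext with (fun y => exists j : {j | le j k}, U (proj1_sig j) y).
  - apply type_lt_ex; [apply small_seg_le|]; intros [j hj]; apply h, hj.
  - intro y; split; [intros [[j hj] hy]; eauto|].
    intros [j [hj hy]]; exists (exist _ j hj); auto.
Qed.

Lemma type_lt_seg (k : K) (U : K -> X -> Prop) : (forall j, lt j k -> type_lt small (U j)) ->
  type_lt small (fun y => exists j, lt j k /\ U j y).
Proof.
  intro h; apply type_lt_ext with (fun y => exists j : {j | lt j k}, U (proj1_sig j) y).
  - apply type_lt_ex; [apply lt_seg|]; intros [j hj]; apply h, hj.
  - intro y; split; [intros [[j hj] hy]; eauto|].
    intros [j [hj hy]]; exists (exist _ j hj); auto.
Qed.

(** [V] is tested only on clopen subsets of [U], so it may fail to be clopen at a point outside [U].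
    This admits clopen subsets of the punctured space. *)
Lemma type_lt_pieces U V : type_lt small U ->
  (forall C, clopen C -> (forall y, C y -> U y) -> clopen (fun y => C y /\ V y)) ->
  type_lt small (fun y => U y /\ V y).
Proof.
  intros [I [C [hI [hC e]]]] hV; exists I, (fun i y => C i y /\ V y); split; [auto|]; split.
  - intro i; apply hV; auto; intros y hy; apply e; eauto.
  - intro y; rewrite e; firstorder.
Qed.

Lemma type_lt_and U V : type_lt small U -> clopen V -> type_lt small (fun y => U y /\ V y).
Proof. intros hU hV; apply type_lt_pieces; auto; intros C hC _; apply clopen_and; auto. Qed.

(** The function with value 1 on [M] and 0 on [N] is continuous on their union; its continuous
    extension keeps the closures of [M] and [N] apart. *)
Lemma type_lt_disjoint_sep (M N : X -> Prop) : compact X -> F_space small X ->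
  type_lt small M -> type_lt small N -> (forall y, ~ (M y /\ N y)) ->
  exists d : X -> Prop, clopen d /\ (forall y, M y -> d y) /\ (forall y, N y -> ~ d y).
Proof.
  intros hX [hz hF] hM hN hd.
  assert (hU := type_lt_or _ _ hM hN).
  pose (f := fun u : subspace (fun y => M y \/ N y) =>
    if excluded_middle_informative (M (proj1_sig u)) then 1 else 0).
  destruct (hF _ (type_lt_open _ hU) hU f) as [g [hg e]].
  - intros [u hu] eps heps.
    destruct (classic (M u)) as [h|h].
    + exists (fun y => M (proj1_sig y)); split; [apply open_subspace_restrict, type_lt_open; auto|].
      split; [exact h|]; intros y hy; unfold f; simpl.
      repeat destruct excluded_middle_informative; try tauto.
      rewrite Rminus_diag, Rabs_R0; exact heps.
    + assert (h' : N u) by tauto.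
      exists (fun y => N (proj1_sig y)); split; [apply open_subspace_restrict, type_lt_open; auto|].
      split; [exact h'|]; intros y hy; unfold f; simpl.
      destruct (excluded_middle_informative (M (proj1_sig y))); [destruct (hd (proj1_sig y)); auto|].
      destruct excluded_middle_informative; try tauto.
      rewrite Rminus_diag, Rabs_R0; exact heps.
  - exists 1; intro u; unfold f; destruct excluded_middle_informative.
    + rewrite Rabs_R1; lra.
    + rewrite Rabs_R0; lra.
  - apply compact_sep; auto; intro y.
    assert (gM : forall z, M z -> g z = 1).
    { intros z hz'; change z with (proj1_sig (exist (fun y => M y \/ N y) z (or_introl hz'))).
      rewrite e; unfold f; simpl; destruct excluded_middle_informative; tauto. }
    assert (gN : forall z, N z -> g z = 0).
    { intros z hz'; change z with (proj1_sig (exist (fun y => M y \/ N y) z (or_intror hz'))).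
      rewrite e; unfold f; simpl; destruct excluded_middle_informative; auto.
      destruct (hd z); auto. }
    (* Where the extension is positive, nearby points avoid [N]; elsewhere it stays below 1 nearby,
       so they avoid [M]. *)
    destruct (Rlt_dec 0 (g y)) as [h|h].
    + destruct (hg y (g y) h) as [W [h1 [h2 h3]]].
      destruct (zero_dim_nbhd W y hz h1 h2) as [V [h4 [h5 h6]]]; exists V; split; [|split]; auto.
      right; intros z hV hN'; specialize (h3 z (h6 z hV)); rewrite (gN z hN') in h3.
      apply Rabs_def2 in h3; lra.
    + destruct (hg y 1 Rlt_0_1) as [W [h1 [h2 h3]]].
      destruct (zero_dim_nbhd W y hz h1 h2) as [V [h4 [h5 h6]]]; exists V; split; [|split]; auto.
      left; intros z hV hM'; specialize (h3 z (h6 z hV)); rewrite (gM z hM') in h3.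
      apply Rabs_def2 in h3; lra.
Qed.
End Types.

Variable S : space.
Hypothesis S_compact : compact S.
Hypothesis S_hausdorff : hausdorff S.
Hypothesis S_zero_dim : zero_dim S.
Hypothesis S_F : F_space small S.
Hypothesis S_G : G_space small S.
Hypothesis S_perfect : no_isolated_points S.
Variable x : S.

(* The coherent clopen pieces on the [a j] are chosen along the order: at each stage the part already
   decided has type less than |K|, so the F-property extends it. *)
Lemma clopen_gluing (P : K -> Prop) (a : K -> S -> Prop) (G H : S -> Prop) :
  (forall i j, P j -> lt i j -> P i) -> (forall j, P j -> clopen (a j)) ->
  (forall j, P j -> type_lt small (fun y => G y /\ a j y)) ->
  (forall j, P j -> type_lt small (fun y => H y /\ a j y)) ->
  (forall y, ~ (G y /\ H y)) ->
  exists g : S -> Prop,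
    (forall j, P j -> clopen (fun y => g y /\ a j y)) /\
    (forall j y, P j -> a j y -> G y -> g y) /\ (forall y, H y -> ~ g y).
Proof.
  intros hP ha hG hH hd.
  destruct (cond_choice ((S -> Prop) * (S -> Prop)) (S -> Prop)
    (fun p => type_lt small (fst p) /\ type_lt small (snd p) /\ forall y, ~ (fst p y /\ snd p y))
    (fun p d => clopen d /\ (forall y, fst p y -> d y) /\ forall y, snd p y -> ~ d y) (fun _ => True))
    as [ch hch].
  { intros [M N] [h1 [h2 h3]]; apply type_lt_disjoint_sep; auto. }
  (* [lo] gathers the points of [a k] already forced into the glued set, [up] those forced out. [L]
     and [R] are the same sets for the actual [g], with indices in [K]. *)
  pose (lo := fun (k : K) (f : {j | lt j k} -> S -> Prop) (y : S) =>
    ((exists j, f j y /\ a (proj1_sig j) y) \/ G y) /\ a k y).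
  pose (up := fun (k : K) (f : {j | lt j k} -> S -> Prop) (y : S) =>
    ((exists j, ~ f j y /\ a (proj1_sig j) y) \/ H y) /\ a k y).
  destruct (wf_fix K (S -> Prop) lt lt_wf (fun k f => ch (lo k f, up k f))) as [g hg].
  pose (L := fun k y => ((exists j, lt j k /\ (g j y /\ a j y)) \/ G y) /\ a k y).
  pose (R := fun k y => ((exists j, lt j k /\ (~ g j y /\ a j y)) \/ H y) /\ a k y).
  assert (hg' : forall k, g k = ch (L k, R k)).
  { intro k; rewrite hg at 1; f_equal; f_equal; apply set_ext; intro y; unfold lo, up, L, R.
    - split.
      + intros [[[[j hj] h]|h] h']; split; eauto.
      + intros [[[j [hj h]]|h] h']; split; auto; left; exists (exist _ j hj); auto.
    - split.
      + intros [[[[j hj] h]|h] h']; split; eauto.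
      + intros [[[j [hj h]]|h] h']; split; auto; left; exists (exist _ j hj); auto. }
  assert (main : forall k, P k -> clopen (g k) /\ (forall y, L k y -> g k y) /\ (forall y, R k y -> ~ g k y)).
  { intro k; induction (lt_wf k) as [k _ IH]; intro hk; rewrite hg'.
    apply (hch (L k, R k)); simpl; split; [|split].
    - apply type_lt_ext with (fun y => (exists j, lt j k /\ ((g j y /\ a j y) /\ a k y)) \/ (G y /\ a k y)).
      + apply type_lt_or; [|auto]; apply type_lt_seg; intros j hj; apply type_lt_clopen.
        apply clopen_and; [apply clopen_and|]; eauto; apply IH; eauto.
      + intro y; unfold L; split; [intros [[j h]|h]; split; try tauto; left; exists j; tauto|].
        intros [[[j h]|h] h']; [left; exists j|right]; tauto.
    - apply type_lt_ext with (fun y => (exists j, lt j k /\ ((~ g j y /\ a j y) /\ a k y)) \/ (H y /\ a k y)).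
      + apply type_lt_or; [|auto]; apply type_lt_seg; intros j hj; apply type_lt_clopen.
        apply clopen_and; [apply clopen_and|]; eauto; apply clopen_not, IH; eauto.
      + intro y; unfold R; split; [intros [[j h]|h]; split; try tauto; left; exists j; tauto|].
        intros [[[j h]|h] h']; [left; exists j|right]; tauto.
    (* If two earlier stages decided [y] differently, the later one would violate a constraint
       imposed by the earlier one. *)
    - intros y [[[[j [hj [h1 h2]]]|h1] _] [[[i [hi [h3 h4]]]|h3] _]].
      + destruct (lt_total i j) as [h|[-> |h]]; [| tauto |].
        * apply (proj2 (proj2 (IH j hj (hP _ _ hk hj)))) with (y := y) in h1; [tauto|].
          split; auto; left; exists i; auto.
        * apply h3, (IH i hi (hP _ _ hk hi)); split; auto; left; exists j; auto.
      + apply (proj2 (proj2 (IH j hj (hP _ _ hk hj)))) with (y := y) in h1; [tauto|].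
        split; auto.
      + apply h3, (IH i hi (hP _ _ hk hi)); split; auto.
      + apply (hd y); auto. }
  (* Coherence on overlaps makes the union of all pieces agree with [g j] on [a j]. *)
  assert (coh : forall i j y, P i -> P j -> a i y -> a j y -> g i y -> g j y).
  { assert (C : forall i j y, P j -> lt i j -> a i y -> a j y -> (g i y <-> g j y)).
    { intros i j y hj hij h1 h2; destruct (main j hj) as [_ [h3 h4]]; split; intro h.
      - apply h3; split; auto; left; exists i; auto.
      - apply NNPP; intro h'; apply (h4 y); auto; split; auto; left; exists i; auto. }
    intros i j y hi hj h1 h2 h; destruct (lt_total i j) as [h3|[<- |h3]]; auto.
    - apply (C i j); auto.
    - apply (C j i); auto. }
  exists (fun y => exists i, P i /\ a i y /\ g i y); split; [|split].
  - intros j hj; apply clopen_ext with (fun y => g j y /\ a j y).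
    + apply clopen_and; [apply main|]; auto.
    + intro y; split; [intros [h1 h2]; split; eauto|].
      intros [[i [h1 [h2 h3]]] h4]; split; eauto.
  - intros j y hj h1 h2; exists j; split; [|split]; auto; apply main; auto; split; auto.
  - intros y hy [i [h1 [h2 h3]]]; apply (proj2 (proj2 (main i h1))) with y; auto; split; auto.
Qed.

(* Membership of [x] in [C] is irrelevant: [C] stands for its trace on the punctured space. *)
Definition punctured_clopen (C : S -> Prop) : Prop :=
  open (fun y => C y /\ y <> x) /\ open (fun y => ~ C y /\ y <> x).

(** Membership of [x] is ignored here too. For clopen subsets of the punctured space these are the
    ones that become empty in the remainder ([represents_null]). *)
Definition null (C : S -> Prop) : Prop :=
  exists V, open V /\ V x /\ forall y, V y -> y <> x -> ~ C y.

Lemma pc_ext (A C : S -> Prop) :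
  punctured_clopen A -> (forall y, y <> x -> (A y <-> C y)) -> punctured_clopen C.
Proof.
  intros [h1 h2] e; split.
  - apply (open_ext _ _ h1); intro y; split; intros [h h']; split; auto; apply (e y h'); auto.
  - apply (open_ext _ _ h2); intro y; split; intros [h h']; split; auto; rewrite (e y h') in *; auto.
Qed.

Lemma pc_not (A : S -> Prop) : punctured_clopen A -> punctured_clopen (fun y => ~ A y).
Proof.
  intros [h1 h2]; split; auto; apply (open_ext _ _ h1).
  intro y; split; intros [h h']; split; auto; apply NNPP; auto.
Qed.

Lemma pc_of_clopen (A : S -> Prop) : clopen A -> punctured_clopen A.
Proof. intros [h1 h2]; split; apply open_inter; auto; apply hausdorff_open_ne; auto. Qed.

Lemma pc_and (A C : S -> Prop) :
  punctured_clopen A -> punctured_clopen C -> punctured_clopen (fun y => A y /\ C y).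
Proof.
  intros [h1 h2] [h3 h4]; split.
  - apply (open_ext _ _ (open_inter _ _ _ h1 h3)); intro y; tauto.
  - apply (open_ext _ _ (open_or _ _ h2 h4)); intro y.
    destruct (classic (A y)), (classic (C y)); tauto.
Qed.

Lemma pc_or (A C : S -> Prop) :
  punctured_clopen A -> punctured_clopen C -> punctured_clopen (fun y => A y \/ C y).
Proof.
  intros h1 h2; apply pc_ext with (fun y => ~ (~ A y /\ ~ C y)).
  - apply pc_not, pc_and; apply pc_not; auto.
  - intros y _; split; [intro h; apply NNPP; tauto | tauto].
Qed.

(** Cut down to a clopen set missing [x], a clopen subset of the punctured space is clopen in [S],
    where the F-property applies. *)
Lemma pc_and_clopen (A C : S -> Prop) :
  punctured_clopen A -> clopen C -> ~ C x -> clopen (fun y => C y /\ A y).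
Proof.
  intros [h1 h2] [h3 h4] h5; split.
  - apply (open_ext _ _ (open_inter _ _ _ h1 h3)); intro y; split; [tauto|].
    intros [h h']; split; auto; split; auto; intros ->; auto.
  - apply (open_ext _ _ (open_or _ _ h2 h4)); intro y.
    destruct (classic (A y)), (classic (C y)); split; try tauto.
    left; split; auto; intros ->; auto.
Qed.

Lemma null_mono (A C : S -> Prop) : null C -> (forall y, y <> x -> A y -> C y) -> null A.
Proof.
  intros [V [h1 [h2 h3]]] h; exists V; split; [|split]; auto; intros y hV hy hA; apply (h3 y); auto.
Qed.

Lemma null_or (A C : S -> Prop) : null A -> null C -> null (fun y => A y \/ C y).
Proof.
  intros [V [h1 [h2 h3]]] [W [h4 [h5 h6]]]; exists (fun y => V y /\ W y); split; [|split].
  - apply open_inter; auto.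
  - auto.
  - intros y [h h'] hy [h7|h7]; [apply (h3 y) | apply (h6 y)]; auto.
Qed.

Lemma null_False : null (fun _ => False).
Proof. exists (fun _ => True); split; [apply open_full|]; tauto. Qed.

Lemma not_null_meets (A V : S -> Prop) :
  ~ null A -> open V -> V x -> exists y, V y /\ y <> x /\ A y.
Proof.
  intros h hV hx; apply NNPP; intro hn; apply h; exists V; split; [|split]; auto.
  intros y h1 h2 h3; apply hn; eauto.
Qed.

Lemma null_clopen (A : S -> Prop) : null A ->
  exists t, clopen t /\ t x /\ forall y, t y -> y <> x -> ~ A y.
Proof.
  intros [V [h1 [h2 h3]]]; destruct (zero_dim_nbhd V x S_zero_dim h1 h2) as [t [h4 [h5 h6]]].
  exists t; auto.
Qed.

Definition thin (A : S -> Prop) : Prop :=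
  forall U, type_lt small U -> ~ U x -> null (fun y => A y /\ U y).

Lemma thin_nbhd (A U : S -> Prop) : thin A -> type_lt small U -> ~ U x ->
  exists t, clopen t /\ t x /\ forall y, t y -> y <> x -> ~ (A y /\ U y).
Proof. intros h hU hx; apply null_clopen, h; auto. Qed.

(** [A] cuts [U] into two disjoint sets of small type. A clopen set of [S] separates them, and the
    part lying on the side without [x] is null. *)
Lemma null_dichotomy (A U : S -> Prop) : punctured_clopen A -> type_lt small U -> ~ U x ->
  null (fun y => A y /\ U y) \/ null (fun y => ~ A y /\ U y).
Proof.
  intros hA hU hx.
  assert (hp : forall A, punctured_clopen A -> type_lt small (fun y => U y /\ A y)).
  { intros A' hA'; apply type_lt_pieces; auto; intros C hC hCU; apply pc_and_clopen; auto. }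
  destruct (type_lt_disjoint_sep (fun y => U y /\ A y) (fun y => U y /\ ~ A y)) as [d [h1 [h2 h3]]];
    auto using pc_not.
  { tauto. }
  destruct (classic (d x)) as [h|h].
  - right; exists d; split; [apply h1|]; split; auto; intros y hd _ [h4 h5]; apply (h3 y); auto.
  - left; exists (fun y => ~ d y); split; [apply h1|]; split; auto; intros y hd _ [h4 h5]; auto.
Qed.

(* Two sets accumulating at [x] inside small sets are both co-null on a common small set,
   by [null_dichotomy], so they cannot be almost disjoint. *)
Lemma thin_or_thin (A D : S -> Prop) : punctured_clopen A -> punctured_clopen D ->
  null (fun y => A y /\ D y) -> thin A \/ thin D.
Proof.
  intros hA hD hn; apply NNPP; intro h; apply not_or_and in h; destruct h as [h1 h2].
  apply not_all_ex_not in h1; destruct h1 as [U h1]; apply imply_to_and in h1; destruct h1 as [hU h1].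
  apply imply_to_and in h1; destruct h1 as [hUx h1].
  apply not_all_ex_not in h2; destruct h2 as [U' h2]; apply imply_to_and in h2; destruct h2 as [hU' h2].
  apply imply_to_and in h2; destruct h2 as [hUx' h2].
  assert (hW := type_lt_or _ _ hU hU').
  destruct (null_dichotomy A _ hA hW) as [h3|h3]; [tauto| |].
  { apply h1, (null_mono _ _ h3); tauto. }
  destruct (null_dichotomy D _ hD hW) as [h4|h4]; [tauto| |].
  { apply h2, (null_mono _ _ h4); tauto. }
  apply h1, (null_mono _ _ (null_or _ _ hn (null_or _ _ h3 h4))); intros y _.
  destruct (classic (A y)), (classic (D y)); tauto.
Qed.

Lemma pc_of_pieces (P : K -> Prop) (a : K -> S -> Prop) (g C : S -> Prop) :
  (forall j, P j -> clopen (a j) /\ ~ a j x) -> (forall j, P j -> clopen (fun y => g y /\ a j y)) ->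
  punctured_clopen C -> (forall y, y <> x -> C y -> exists j, P j /\ a j y) ->
  punctured_clopen (fun y => g y /\ C y).
Proof.
  intros ha hg [hC hC'] hc; split.
  - apply open_ext with (fun y => exists j, P j /\ ((g y /\ a j y) /\ (C y /\ y <> x))).
    + apply open_ex; intro j; apply open_local; intros y [hj hy].
      exists (fun y => (g y /\ a j y) /\ (C y /\ y <> x)); split; [|split; auto].
      apply open_inter; auto; apply hg; auto.
    + intro y; split; [intros [j h]; tauto|]; intros [[h1 h2] h3].
      destruct (hc y h3 h2) as [j [h4 h5]]; exists j; tauto.
  - apply open_ext with (fun y => (~ C y /\ y <> x) \/
      (exists j, P j /\ ((~ (g y /\ a j y) /\ a j y) /\ (C y /\ y <> x)))).
    + apply open_or; auto; apply open_ex; intro j; apply open_local; intros y [hj hy].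
      exists (fun y => (~ (g y /\ a j y) /\ a j y) /\ (C y /\ y <> x)); split; [|split; auto].
      apply open_inter; auto; apply open_inter; [apply hg|apply ha]; auto.
    + intro y; split; [intros [h|[j h]]; tauto|]; intros [h1 h2].
      destruct (classic (C y)) as [h|h]; [right|left; auto].
      destruct (hc y h2 h) as [j [h4 h5]]; exists j; tauto.
Qed.

(** Off a neighbourhood of [x] missing [D], compactness leaves finitely many [a j] to cover [D], and
    their indices are bounded in [P]. The use is contrapositive: a set that is never covered by the
    pieces before a stage [m] is not null. *)
Lemma null_bounded (P : K -> Prop) (a : K -> S -> Prop) (D C : S -> Prop) :
  (forall j, P j -> clopen (a j) /\ ~ a j x) -> punctured_clopen C ->
  (forall y, y <> x -> C y -> exists j, P j /\ a j y) ->
  (exists j, P j) -> (forall j, P j -> exists k, P k /\ lt j k) ->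
  (forall y, y <> x -> D y -> C y) -> null D ->
  exists m, P m /\ forall y, y <> x -> D y -> exists j, P j /\ lt j m /\ a j y.
Proof.
  intros ha [_ hC] hc [j0 hj0] hP hD [V [h1 [h2 h3]]].
  destruct (S_compact (fun U => U = V \/ U = (fun y => ~ C y /\ y <> x) \/ exists j, P j /\ U = a j))
    as [l [hl hlc]].
  - intros U [-> |[-> |[j [hj ->]]]]; auto; apply ha; auto.
  - intro y; destruct (classic (y = x)) as [-> |hy]; [exists V; auto|].
    destruct (classic (C y)) as [h|h].
    + destruct (hc y hy h) as [j [h4 h5]]; exists (a j); split; eauto.
    + exists (fun y => ~ C y /\ y <> x); auto.
  - assert (H : forall l' : list (S -> Prop),
      (forall U, In U l' -> U = V \/ U = (fun y => ~ C y /\ y <> x) \/ exists j, P j /\ U = a j) ->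
      exists m, P m /\ forall y U, y <> x -> D y -> In U l' -> U y -> exists j, P j /\ lt j m /\ a j y).
    { induction l' as [|U l' IH]; intro h; [exists j0; split; auto; intros y U _ _ []|].
      destruct IH as [m [hm1 hm2]]; [intros U' hU'; apply h; right; auto|].
      destruct (h U (or_introl eq_refl)) as [-> |[-> |[j [hj ->]]]].
      - exists m; split; auto; intros y U' hy hDy [<- |hU'] hUy; [destruct (h3 y); auto | eauto].
      - exists m; split; auto; intros y U' hy hDy [<- |hU'] hUy; [destruct hUy as [hn _]; destruct hn; auto | eauto].
      - assert (hk : exists k, P k /\ lt j k /\ le m k).
        { destruct (le_total m j) as [h4|h4].
          - destruct (hP j hj) as [k [h5 h6]]; exists k; split; [|split]; auto; right.
            apply le_lt_trans with j; auto.
          - destruct (hP m hm1) as [k [h5 h6]]; exists k; split; [|split]; auto.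
            apply le_lt_trans with m; auto. }
        destruct hk as [k [h4 [h5 h6]]]; exists k; split; auto.
        intros y U' hy hDy [<- |hU'] hUy; [exists j; auto|].
        destruct (hm2 y U' hy hDy hU' hUy) as [i [h7 [h8 h9]]]; exists i; split; [|split]; auto.
        destruct h6 as [<- |h6]; eauto. }
    destruct (H l hl) as [m [hm1 hm2]]; exists m; split; auto; intros y hy hDy.
    destruct (hlc y) as [U [hU hUy]]; eauto.
Qed.

Lemma small_intersection_clopen (I : Type) (O : I -> S -> Prop) (O0 : S -> Prop) (p : S) :
  card_lt I K -> open O0 -> (forall i, open (O i)) -> p <> x -> O0 p -> (forall i, O i p) ->
  exists e, clopen e /\ (exists y, e y) /\ ~ e x /\
    (forall y, e y -> O0 y /\ forall i, O i y).
Proof.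
  intros hI hO0 hO hp h0 h1.
  destruct (S_G {b : bool & if b then I else unit}
    (fun q y => match q with existT true i => O i y | existT false _ => O0 y /\ y <> x end))
    as [W [hW [[z hz] hWO]]].
  - apply card_lt_sigma; auto; [apply card_lt_bool; auto|]; intros []; auto using small_unit.
  - intros [[] i]; auto; apply open_inter; auto using hausdorff_open_ne.
  - exists p; intros [[] i]; auto.
  - assert (hs : forall y, W y -> (O0 y /\ y <> x) /\ forall i, O i y).
    { intros y hy; split.
      - apply (hWO y hy (existT (fun b : bool => if b then I else unit) false tt)).
      - intro i; apply (hWO y hy (existT (fun b : bool => if b then I else unit) true i)). }
    destruct (zero_dim_nbhd W z S_zero_dim hW hz) as [e [h2 [h3 h4]]].
    exists e; split; [|split; [|split]]; eauto.
    + intro h; apply (hs x); auto.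
    + intros y hy; split; [apply (hs y) | apply hs]; auto.
Qed.

(** * Families of [|K|] many clopen sets: separation, pseudo-intersection, splitting *)

Variable c : K -> S -> Prop.
Hypothesis c_clopen : forall j, clopen (c j) /\ ~ c j x.
Hypothesis c_cover : forall y, y <> x -> exists j, c j y.

(** [G] and [H] may themselves have type [|K|]: only their parts on each [c j] have to be small. *)
Lemma glue_cover (G H : S -> Prop) :
  (forall j, type_lt small (fun y => G y /\ c j y)) ->
  (forall j, type_lt small (fun y => H y /\ c j y)) ->
  (forall y, ~ (G y /\ H y)) ->
  exists g, punctured_clopen g /\ (forall y, y <> x -> G y -> g y) /\ (forall y, H y -> ~ g y).
Proof.
  intros hG hH hd.
  destruct (clopen_gluing (fun _ => True) c G H) as [g [h1 [h2 h3]]]; auto.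
  { intros j _; apply c_clopen. }
  exists g; split; [|split]; auto.
  - apply pc_ext with (fun y => g y /\ True); [|tauto].
    apply pc_of_pieces with (P := fun _ => True) (a := c); auto.
    + apply pc_ext with (fun _ => ~ False); [apply pc_not, pc_of_clopen, clopen_false | tauto].
    + intros y hy _; destruct (c_cover y hy) as [j hj]; eauto.
  - intros y hy hGy; destruct (c_cover y hy) as [j hj]; eauto.
Qed.

Lemma type_lt_slice (t D : S -> Prop) (j : K) : clopen t -> punctured_clopen D ->
  type_lt small (fun y => (t y /\ y <> x /\ D y) /\ c j y).
Proof.
  intros ht hD; apply type_lt_clopen.
  apply clopen_ext with (fun y => t y /\ (c j y /\ D y)).
  - apply clopen_and; auto; apply pc_and_clopen; auto; apply c_clopen.
  - intro y; split; [|tauto]; intros [h1 [h2 h3]]; split; auto; split; auto; split; auto.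
    intros ->; apply (c_clopen j); auto.
Qed.

(** Trimming [D k] to [t k] removes it from every [c j] with [j <= k], so only the fewer than [|K|]
    members with [k < j] reach [c j]. *)
Lemma type_lt_family_slice (t D : K -> S -> Prop) (j : K) :
  (forall k, clopen (t k)) -> (forall k, punctured_clopen (D k)) ->
  (forall k y, le j k -> y <> x -> c j y -> t k y -> ~ D k y) ->
  type_lt small (fun y => (exists k, t k y /\ y <> x /\ D k y) /\ c j y).
Proof.
  intros ht hD h.
  apply type_lt_ext with (fun y => exists k, lt k j /\ ((t k y /\ y <> x /\ D k y) /\ c j y)).
  - apply type_lt_seg; intros k _; apply type_lt_slice; auto.
  - intro y; split; [intros [k [_ [h1 h2]]]; eauto|].
    intros [[k [h1 [h2 h3]]] h4]; exists k; split; auto.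
    apply NNPP; intro hk; apply not_lt_le in hk; apply (h k y); auto.
Qed.

(** [U k] consists of the pieces [c j] and the overlaps of [A i] with [D j], all indices up to [k].
    It is small and misses [x], so the thin sets [A k] and [D k] avoid it on a neighbourhood [t k]
    of [x]. After trimming to [t k], avoiding the pieces makes every slice small, and avoiding the
    overlaps makes the two families disjoint. *)
Lemma thin_families_sep (A D : K -> S -> Prop) :
  (forall k, punctured_clopen (A k)) -> (forall k, punctured_clopen (D k)) ->
  (forall k l, null (fun y => A k y /\ D l y)) ->
  (forall k, thin (A k)) -> (forall k, thin (D k)) ->
  exists C, punctured_clopen C /\ (forall k, null (fun y => A k y /\ ~ C y)) /\
    (forall k, null (fun y => D k y /\ C y)).
Proof.
  intros hA hD hn tA tD.
  (* A null overlap, with [x] removed, is clopen in [S] and not merely in the punctured space. *)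
  assert (hAD : forall i j, type_lt small (fun y => y <> x /\ A i y /\ D j y)).
  { intros i j; apply type_lt_clopen; destruct (hn i j) as [V [h1 [h2 h3]]].
    destruct (pc_and _ _ (hA i) (hD j)) as [h4 h5]; split.
    - apply (open_ext _ _ h4); intro y; tauto.
    - apply (open_ext _ _ (open_or _ _ h5 h1)); intro y; split.
      + intros [h|h]; [tauto|]; intros [h6 h7]; apply (h3 y); auto.
      + destruct (classic (y = x)) as [-> |hy]; auto; tauto. }
  pose (U := fun k y => (exists j, le j k /\ c j y) \/
     (exists i, le i k /\ exists j, le j k /\ (y <> x /\ A i y /\ D j y))).
  assert (hU : forall k, type_lt small (U k)).
  { intro k; apply type_lt_or; apply type_lt_seg_le; intros j hj.
    - apply type_lt_clopen, c_clopen.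
    - apply type_lt_seg_le; auto. }
  assert (hUx : forall k, ~ U k x).
  { intros k [[j [_ h]]|[i [_ [j [_ h]]]]]; [apply (c_clopen j)|]; tauto. }
  assert (ht : forall k, exists t, clopen t /\ t x /\
     forall y, t y -> y <> x -> U k y -> ~ A k y /\ ~ D k y).
  { intro k; destruct (null_clopen _ (null_or _ _ (tA k _ (hU k) (hUx k)) (tD k _ (hU k) (hUx k))))
      as [t [h1 [h2 h3]]].
    exists t; split; [|split]; auto; intros y h4 h5 h6; specialize (h3 y h4 h5); tauto. }
  apply choice_fun in ht; destruct ht as [t ht].
  destruct (glue_cover (fun y => exists k, t k y /\ y <> x /\ A k y)
    (fun y => exists k, t k y /\ y <> x /\ D k y)) as [g [h1 [h2 h3]]].
  - intro j; apply type_lt_family_slice; auto; [intro k; apply ht|].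
    intros k y hk hy h4 h5; apply (ht k); auto; left; eauto.
  - intro j; apply type_lt_family_slice; auto; [intro k; apply ht|].
    intros k y hk hy h4 h5; apply (ht k); auto; left; eauto.
  - intros y [[k [h1 [h2 h3]]] [l [h4 [_ h5]]]].
    destruct (le_total k l) as [h|h].
    + destruct (proj2 (proj2 (ht l)) y) as [n1 n2]; auto; right; exists k; split; auto; exists l; auto.
    + destruct (proj2 (proj2 (ht k)) y) as [n1 n2]; auto; right; exists k; split; auto; exists l; auto.
  - exists g; split; [|split]; auto; intro k; exists (t k);
      (split; [apply ht|]; split; [apply ht|]); intros y h4 h5 [h6 h7].
    + apply h7, h2; eauto.
    + apply (h3 y); eauto.
Qed.

(** Whatever is almost disjoint from the non-thin [A k0] is thin: each [D l], and each [A k] without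
    [A k0]. Those are separated, and [A k0] is added back. *)
Lemma not_thin_family_sep (A D : K -> S -> Prop) (k0 : K) :
  (forall k, punctured_clopen (A k)) -> (forall k, punctured_clopen (D k)) ->
  (forall k l, null (fun y => A k y /\ D l y)) -> ~ thin (A k0) ->
  exists C, punctured_clopen C /\ (forall k, null (fun y => A k y /\ ~ C y)) /\
    (forall k, null (fun y => D k y /\ C y)).
Proof.
  intros hA hD hn ht.
  assert (hA' : forall k, punctured_clopen (fun y => A k y /\ ~ A k0 y))
    by (intro k; apply pc_and; auto using pc_not).
  destruct (thin_families_sep (fun k y => A k y /\ ~ A k0 y) D) as [C [h1 [h2 h3]]]; auto.
  - intros k l; apply (null_mono _ _ (hn k l)); tauto.
  - intro k; destruct (thin_or_thin (A k0) (fun y => A k y /\ ~ A k0 y)) as [h|h]; auto; [|tauto].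
    apply (null_mono _ _ null_False); tauto.
  - intro k; destruct (thin_or_thin (A k0) (D k)) as [h|h]; auto; tauto.
  - exists (fun y => C y \/ A k0 y); split; [apply pc_or; auto|]; split; intro k.
    + apply (null_mono _ _ (h2 k)); tauto.
    + apply (null_mono _ _ (null_or _ _ (h3 k) (hn k0 k))); tauto.
Qed.

Lemma families_sep (A D : K -> S -> Prop) :
  (forall k, punctured_clopen (A k)) -> (forall k, punctured_clopen (D k)) ->
  (forall k l, null (fun y => A k y /\ D l y)) ->
  exists C, punctured_clopen C /\ (forall k, null (fun y => A k y /\ ~ C y)) /\
    (forall k, null (fun y => D k y /\ C y)).
Proof.
  intros hA hD hn.
  destruct (classic (exists k, ~ thin (A k))) as [[k h]|h]; [apply not_thin_family_sep with k; auto|].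
  destruct (classic (exists k, ~ thin (D k))) as [[k h']|h'].
  - destruct (not_thin_family_sep D A k) as [C [h1 [h2 h3]]]; auto.
    + intros i j; apply (null_mono _ _ (hn j i)); tauto.
    + exists (fun y => ~ C y); split; [apply pc_not; auto|]; split; intro i.
      * apply (null_mono _ _ (h3 i)); intros y _ [h4 h5]; split; auto; apply NNPP; auto.
      * apply h2.
  - apply thin_families_sep; auto; intro k; apply NNPP; eauto.
Qed.

Lemma meets_outside (A U : S -> Prop) : ~ null A -> null (fun y => A y /\ U y) ->
  exists y, y <> x /\ A y /\ ~ U y.
Proof.
  intros h1 [V [h2 [h3 h4]]]; destruct (not_null_meets A V h1 h2 h3) as [y [h5 [h6 h7]]].
  exists y; split; [|split]; auto; intro h8; apply (h4 y); auto.
Qed.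

Lemma closed_and_nbhd (A b : S -> Prop) : punctured_clopen A -> clopen b -> b x ->
  clopen (fun y => ~ b y /\ A y).
Proof. intros hA hb hx; apply pc_and_clopen; auto using clopen_not. Qed.

(* Witnesses for the earlier stages form a small subset of the thin set [A0], so they stay away from
   [x]; compactness of that part of [S] then gives a witness for the whole initial segment. *)
Lemma thin_segment_meets (A : K -> S -> Prop) (A0 : S -> Prop) :
  (forall k, punctured_clopen (A k)) -> punctured_clopen A0 -> thin A0 ->
  (forall l : list K, ~ null (fun y => A0 y /\ forall k, In k l -> A k y)) ->
  forall k (l : list K) U, type_lt small U -> ~ U x ->
  exists y, y <> x /\ A0 y /\ (forall i, In i l -> A i y) /\ (forall j, lt j k -> A j y) /\ ~ U y.
Proof.
  intros hA hA0 ht hl k; induction (lt_wf k) as [k _ IH]; intros l U hU hUx.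
  destruct (classic (exists j, lt j k)) as [[j0 hj0]|hno].
  2:{ destruct (meets_outside _ U (hl l)) as [y [h1 [[h2 h3] h4]]].
      - apply (null_mono _ _ (ht U hU hUx)); tauto.
      - exists y; split; [|split; [|split; [|split]]]; auto; intros j hj; destruct hno; eauto. }
  (* The list absorbs the stage itself: with [i :: l], the witness [p i] lies in [A j] for all [j]
     up to and including [i]. *)
  destruct (cond_choice K S (fun i => lt i k) (fun i y => y <> x /\ A0 y /\
    (forall m, In m (i :: l) -> A m y) /\ (forall j, lt j i -> A j y) /\ ~ U y) x) as [p hp].
  { intros i hi; apply IH; auto. }
  destruct (cond_choice K (S -> Prop) (fun i => lt i k) (fun i e => clopen e /\ e (p i) /\
    forall y, e y -> A0 y /\ y <> x) (fun _ => True)) as [e he].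
  { intros i hi; destruct (zero_dim_nbhd _ (p i) S_zero_dim (proj1 hA0)) as [e [h1 [h2 h3]]].
    - split; apply (hp i hi).
    - exists e; split; [|split]; auto. }
  (* Thinness speaks of sets of small type, so the witnesses are fattened to clopen sets inside
     [A0]; the resulting [b] keeps all of them away from [x]. *)
  assert (hV : type_lt small (fun y => exists i, lt i k /\ e i y)).
  { apply type_lt_seg; intros i hi; apply type_lt_clopen, he; auto. }
  destruct (thin_nbhd _ _ ht hV) as [b [hb [hbx hb']]].
  { intros [i [hi h]]; apply (he i hi) in h; tauto. }
  assert (hpb : forall i, lt i k -> ~ b (p i)).
  { intros i hi h; apply (hb' (p i)); auto; [apply (hp i hi)|]; split; [apply (hp i hi)|].
    exists i; split; auto; apply he; auto. }
  destruct (compact_directed {i | lt i k} (fun i y => ~ b y /\ A0 y /\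
    (forall m, In m l -> A m y) /\ (forall j, le j (proj1_sig i) -> A j y) /\ ~ U y)) as [y hy].
  - exact S_compact.
  - constructor; exists j0; exact hj0.
  (* Closedness: off [b] the sets [A0] and [A m] are clopen in [S], and [U] is open. *)
  - intros [i hi]; simpl; apply open_local; intros y hy.
    assert (hcl : forall B, punctured_clopen B -> ~ (~ b y /\ B y) ->
      exists V, open V /\ V y /\ forall z, V z -> ~ (~ b z /\ B z)).
    { intros B hB h; exists (fun z => ~ (~ b z /\ B z)); split; [|split]; auto.
      apply closed_and_nbhd; auto. }
    assert (hc : (exists B, punctured_clopen B /\ ~ (~ b y /\ B y) /\ (B = A0 \/ exists m, B = A m /\ (In m l \/ le m i)))
       \/ U y).
    { apply NNPP; intro hn; apply not_or_and in hn; destruct hn as [hn hn'].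
      assert (hn2 : forall B, punctured_clopen B -> (B = A0 \/ exists m, B = A m /\ (In m l \/ le m i)) ->
         ~ b y /\ B y) by (intros B h1 h2; apply NNPP; intro; apply hn; exists B; auto).
      apply hy; split; [apply (hn2 A0); auto|]; split; [apply (hn2 A0); auto|].
      split; [|split; auto]; intros m hm; apply (hn2 (A m)); eauto. }
    destruct hc as [[B [h1 [h2 h3]]]|h].
    + destruct (hcl B h1 h2) as [V [h4 [h5 h6]]]; exists V; split; [|split]; auto.
      intros z hz [h7 [h8 [h9 [h10 _]]]]; apply (h6 z hz); split; auto.
      destruct h3 as [-> |[m [-> [h3|h3]]]]; auto.
    + exists U; split; [apply type_lt_open; auto|]; split; auto; tauto.
  - intros [i hi]; exists (p i); split; [auto|]; destruct (hp i hi) as [h1 [h2 [h3 [h4 h5]]]].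
    split; auto; split; [intros m hm; apply h3; right; auto|]; split; auto; simpl.
    intros j [-> |hj]; auto; apply h3; left; auto.
  - intros [i hi] [j hj]; simpl; destruct (le_total i j) as [h|h].
    + exists (exist _ j hj); simpl; intros y [h1 [h2 [h3 [h4 h5]]]]; split; [|tauto].
      split; [|split; [|split; [|split]]]; auto; intros m hm; apply h4, le_trans with i; auto.
    + exists (exist _ i hi); simpl; intros y [h1 [h2 [h3 [h4 h5]]]]; split; [tauto|].
      split; [|split; [|split; [|split]]]; auto; intros m hm; apply h4, le_trans with j; auto.
  - exists y; destruct (hy (exist _ j0 hj0)) as [h1 [h2 [h3 [_ h4]]]].
    split; [intros ->; auto|]; split; auto; split; auto; split; auto.
    intros j hj; apply (hy (exist _ j hj)); left; reflexivity.
Qed.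

(** Non-thinness supplies a small non-null [U] missing [x], and makes every complement of an [A k]
    thin. The glued set contains [U], hence is not null, and avoids each complement trimmed to a
    neighbourhood [t k] on which it misses [U] and the pieces up to [k]. *)
Lemma not_thin_pseudo_intersection (A : K -> S -> Prop) :
  (forall k, punctured_clopen (A k)) -> (forall k, ~ thin (A k)) ->
  exists C, punctured_clopen C /\ ~ null C /\ forall k, null (fun y => C y /\ ~ A k y).
Proof.
  intros hA ht; destruct (two_points K K_infinite) as [k0 _].
  assert (hU : exists U, type_lt small U /\ ~ U x /\ ~ null U).
  { apply NNPP; intro hn; apply (ht k0); intros U hU hUx; apply NNPP; intro h; apply hn.
    exists U; split; [|split]; auto; intro h'; apply h, (null_mono _ _ h'); tauto. }
  destruct hU as [U [hU [hUx hUn]]].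
  assert (hD : forall k, thin (fun y => ~ A k y)).
  { intro k; destruct (thin_or_thin (A k) (fun y => ~ A k y)) as [h|h]; auto using pc_not.
    - apply (null_mono _ _ null_False); tauto.
    - destruct (ht k h). }
  assert (hs : forall k, exists t, clopen t /\ t x /\
     forall y, t y -> y <> x -> ~ A k y -> ~ U y /\ forall j, le j k -> ~ c j y).
  { intro k; destruct (thin_nbhd _ (fun y => U y \/ exists j, le j k /\ c j y) (hD k)) as [t [h1 [h2 h3]]].
    - apply type_lt_or; auto; apply type_lt_seg_le; intros j _; apply type_lt_clopen, c_clopen.
    - intros [h|[j [_ h]]]; [auto|apply (c_clopen j); auto].
    - exists t; split; [|split]; auto; intros y h4 h5 h6; split; [intro h7|intros j h7 h8];
        apply (h3 y); eauto. }
  apply choice_fun in hs; destruct hs as [t hs].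
  destruct (glue_cover U (fun y => exists k, t k y /\ y <> x /\ ~ A k y)) as [g [h1 [h2 h3]]].
  - intro j; apply type_lt_and; auto; apply c_clopen.
  - intro j; apply (type_lt_family_slice t (fun k y => ~ A k y)).
    + intro k; apply hs.
    + intro k; apply pc_not; auto.
    + intros k y hk hy h4 h5 h6; apply (hs k) with (j := j) in h6; auto.
  - intros y [h [k [h4 [h5 h6]]]]; apply (hs k) in h6; tauto.
  - exists g; split; [|split]; auto.
    + intro h; apply hUn, (null_mono _ _ h); auto.
    + intro k; exists (t k); split; [apply hs|]; split; [apply hs|]; intros y h4 h5 [h6 h7].
      apply (h3 y); eauto.
Qed.

(** The glued set contains clopen sets [e k], each inside [A0] and the earlier [A j] but outside the
    earlier [c j]; by [null_bounded] this prevents nullness. It avoids the parts of [A0] outside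
    [A k], trimmed to [t k], and is finally intersected with [A0]. *)
Lemma thin_pseudo_intersection (A : K -> S -> Prop) (A0 : S -> Prop) :
  (forall k, punctured_clopen (A k)) -> punctured_clopen A0 -> thin A0 ->
  (forall l : list K, ~ null (fun y => A0 y /\ forall k, In k l -> A k y)) ->
  exists C, punctured_clopen C /\ ~ null C /\ forall k, null (fun y => C y /\ ~ A k y).
Proof.
  intros hA hA0 ht hl.
  assert (he : forall k, exists e, clopen e /\ (exists y, e y) /\ ~ e x /\
    forall y, e y -> A0 y /\ forall j, lt j k -> A j y /\ ~ c j y).
  { intro k.
    destruct (thin_segment_meets A A0 hA hA0 ht hl k nil (fun y => exists j, lt j k /\ c j y))
      as [p [h1 [h2 [_ [h3 h4]]]]].
    - apply type_lt_seg; intros j _; apply type_lt_clopen, c_clopen.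
    - intros [j [_ h]]; apply (c_clopen j); auto.
    - destruct (small_intersection_clopen {j | lt j k}
        (fun j y => (A (proj1_sig j) y /\ y <> x) /\ ~ c (proj1_sig j) y) (fun y => A0 y /\ y <> x) p)
        as [e [h5 [h6 [h7 h8]]]]; auto.
      + apply hA0.
      + intros j; apply open_inter; [apply hA | apply c_clopen].
      + intros [j hj]; simpl; split; auto; intro h; apply h4; eauto.
      + exists e; split; [|split; [|split]]; auto; intros y hy; destruct (h8 y hy) as [h9 h10].
        split; [tauto|]; intros j hj; specialize (h10 (exist _ j hj)); simpl in h10; tauto. }
  apply choice_fun in he; destruct he as [e he].
  (* The bound [j <= k] is not strict, because [e k] lies in the [A j] with [j < k] but perhaps not
     in [A k]. *)
  assert (hs : forall k, exists t, clopen t /\ t x /\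
     forall y, t y -> y <> x -> A0 y /\ ~ A k y -> forall j, le j k -> ~ c j y /\ ~ e j y).
  { intro k; destruct (thin_nbhd _ (fun y => exists j, le j k /\ (c j y \/ e j y)) ht) as [t [h1 [h2 h3]]].
    - apply type_lt_seg_le; intros j _; apply type_lt_clopen, clopen_or; [apply c_clopen|apply he].
    - intros [j [_ [h|h]]]; [apply (c_clopen j); auto|apply (he j); auto].
    - exists t; split; [|split]; auto; intros y h4 h5 [h6 h7] j h8.
      split; intro h9; apply (h3 y h4 h5); split; eauto. }
  apply choice_fun in hs; destruct hs as [t hs].
  destruct (glue_cover (fun y => exists k, e k y)
    (fun y => exists k, t k y /\ y <> x /\ (A0 y /\ ~ A k y))) as [g [h1 [h2 h3]]].
  - intro j; apply type_lt_ext with (fun y => exists k, le k j /\ (e k y /\ c j y)).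
    + apply type_lt_seg_le; intros k _; apply type_lt_clopen, clopen_and; [apply he|apply c_clopen].
    + intro y; split; [intros [k h]; split; [exists k|]; tauto|]; intros [[k h4] h5].
      exists k; split; auto; apply not_lt_le; intro h6; apply (he k) in h4.
      apply (proj2 (proj2 h4 j h6)); auto.
  - intro j; apply (type_lt_family_slice t (fun k y => A0 y /\ ~ A k y)).
    + intro k; apply hs.
    + intro k; apply pc_and; auto using pc_not.
    + intros k y hk hy h4 h5 h6; apply (hs k) with (j := j) in h6; tauto.
  - intros y [[j h4] [k [h5 [h6 h7]]]]; destruct (classic (lt k j)) as [h|h].
    + apply (he j) in h4; apply h7, h4; auto.
    + apply not_lt_le in h; apply (hs k) with (j := j) in h7; tauto.
  - exists (fun y => g y /\ A0 y); split; [apply pc_and; auto|]; split.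
    + intro hn.
      destruct (null_bounded (fun _ => True) c (fun y => g y /\ A0 y) (fun _ => True))
        as [m [_ hm]]; auto.
      * apply pc_ext with (fun _ => ~ False); [apply pc_not, pc_of_clopen, clopen_false | tauto].
      * intros y hy _; destruct (c_cover y hy) as [j hj]; eauto.
      * destruct (two_points K K_infinite) as [k0 _]; eauto.
      * intros j _; destruct (no_max j) as [k hk]; eauto.
      * destruct (he m) as [h4 [[y hy] [h5 h6]]].
        assert (hyx : y <> x) by (intros ->; auto).
        destruct (h6 y hy) as [h7 h8]; destruct (hm y hyx) as [j [_ [h9 h10]]].
        { split; auto; apply h2; eauto. }
        apply (proj2 (h8 j h9)); auto.
    + intro k; exists (t k); split; [apply hs|]; split; [apply hs|]; intros y h4 h5 [[h6 h7] h8].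
      apply (h3 y); auto; exists k; auto.
Qed.

Lemma pseudo_intersection (A : K -> S -> Prop) :
  (forall k, punctured_clopen (A k)) ->
  (forall l : list K, ~ null (fun y => forall k, In k l -> A k y)) ->
  exists C, punctured_clopen C /\ ~ null C /\ forall k, null (fun y => C y /\ ~ A k y).
Proof.
  intros hA hl; destruct (classic (exists k, thin (A k))) as [[k hk]|h].
  - apply thin_pseudo_intersection with (A k); auto; intros l hn; apply (hl (k :: l)).
    apply (null_mono _ _ hn); intros y _ h; split; [apply h; left; auto|].
    intros i hi; apply h; right; auto.
  - apply not_thin_pseudo_intersection; auto; intros k hk; apply h; eauto.
Qed.

(** By recursion: the last hypothesis provides a point of [C] outside all earlier [a j] and [e j],
    and the G-property of [S] fattens it to a clopen set. *)
Lemma disjoint_pieces (P : K -> Prop) (a : K -> S -> Prop) (C : S -> Prop) :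
  punctured_clopen C -> (forall j, P j -> clopen (a j) /\ ~ a j x) ->
  (forall i j, P j -> lt i j -> P i) ->
  (forall i (b : K -> S -> Prop), P i -> (forall j, lt j i -> clopen (b j) /\ ~ b j x) ->
     exists y, y <> x /\ C y /\ forall j, lt j i -> ~ b j y) ->
  exists e : K -> S -> Prop, forall i, P i -> (clopen (e i) /\ (exists y, e i y) /\ ~ e i x /\
    (forall y, e i y -> C y)) /\ forall j y, lt j i -> e i y -> ~ a j y /\ ~ e j y.
Proof.
  intros hC ha hP hb.
  pose (ok := fun e : S -> Prop => clopen e /\ (exists y, e y) /\ ~ e x /\ forall y, e y -> C y).
  destruct (cond_choice (S -> Prop) (S -> Prop)
    (fun W => exists e, ok e /\ forall y, e y -> ~ W y)
    (fun W e => ok e /\ forall y, e y -> ~ W y) (fun _ => True)) as [ch hch]; [auto|].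
  destruct (wf_fix K (S -> Prop) lt lt_wf
    (fun k f => ch (fun y => exists j, a (proj1_sig j) y \/ f j y))) as [e he].
  assert (main : forall k, P k -> ok (e k) /\ forall y, e k y -> ~ (exists j : {j | lt j k}, a (proj1_sig j) y \/ e (proj1_sig j) y)).
  { intro k; induction (lt_wf k) as [k _ IH]; intro hk; rewrite he; apply hch.
    destruct (hb k (fun j y => a j y \/ e j y) hk) as [p [h1 [h2 h3]]].
    { intros j hj; destruct (ha j (hP _ _ hk hj)) as [h4 h5].
      destruct (IH j hj (hP _ _ hk hj)) as [[h6 [_ [h7 _]]] _].
      split; [apply clopen_or; auto|tauto]. }
    destruct (small_intersection_clopen {j | lt j k} (fun j y => ~ (a (proj1_sig j) y \/ e (proj1_sig j) y))
      (fun y => C y /\ y <> x) p) as [d [h4 [h5 [h6 h7]]]]; auto.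
    - apply hC.
    - intros [j hj]; simpl; apply (clopen_or (a j) (e j)); [apply ha|apply IH]; eauto.
    - intros [j hj]; simpl; auto.
    - exists d; split; [split; [|split; [|split]]; auto; intros y hy; apply h7; auto|].
      intros y hy [j hj]; apply (proj2 (h7 y hy) j hj). }
  exists e; intros i hi; split; [apply main; auto|]; intros j y hj hy.
  destruct (main i hi) as [_ h]; specialize (h y hy).
  split; intro h'; apply h; exists (exist _ j hj); auto.
Qed.

(* [P] is an initial segment of least length whose clopen sets [a] can cover [C]. *)
Lemma minimal_cover (C : S -> Prop) : punctured_clopen C -> ~ null C ->
  exists (P : K -> Prop) (a : K -> S -> Prop),
    (forall i j, P j -> lt i j -> P i) /\ (forall j, P j -> clopen (a j) /\ ~ a j x) /\
    (exists j, P j) /\ (forall j, P j -> exists k, P k /\ lt j k) /\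
    (forall y, y <> x -> C y -> exists j, P j /\ a j y) /\
    (forall i (b : K -> S -> Prop), P i -> (forall j, lt j i -> clopen (b j) /\ ~ b j x) ->
       exists y, y <> x /\ C y /\ forall j, lt j i -> ~ b j y).
Proof.
  intros hC hn.
  pose (T := fun k => exists b : K -> S -> Prop, (forall j, lt j k -> clopen (b j) /\ ~ b j x) /\
    forall y, y <> x -> C y -> exists j, lt j k /\ b j y).
  (* [P] is the segment below the least [k] with [T k], or all of [K] if there is none; in the
     latter case [c] is the cover. *)
  pose (P := fun j => forall k, le k j -> ~ T k).
  assert (ha : exists a : K -> S -> Prop, (forall j, P j -> clopen (a j) /\ ~ a j x) /\
    forall y, y <> x -> C y -> exists j, P j /\ a j y).
  { destruct (classic (exists k, T k)) as [hT|hT].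
    - destruct (wf_min _ _ lt_wf _ hT) as [k [[b [h1 h2]] h3]].
      assert (hPk : forall j, lt j k <-> P j).
      { intro j; split.
        - intros hj i hi; apply h3, le_lt_trans with j; auto.
        - intro hj; apply NNPP; intro h; apply not_lt_le in h; apply (hj k h).
          exists b; auto. }
      exists b; split; [intros j hj; apply h1, hPk, hj|].
      intros y h4 h5; destruct (h2 y h4 h5) as [j [h6 h7]]; exists j; split; auto; apply hPk, h6.
    - exists c; split; [intros j _; apply c_clopen|].
      intros y hy _; destruct (c_cover y hy) as [j hj]; exists j; split; auto.
      intros k _ h; apply hT; eauto. }
  destruct ha as [a [ha1 ha2]]; exists P, a.
  assert (hP : forall i j, P j -> lt i j -> P i).
  { intros i j hj hij k hk; apply hj; right; apply le_lt_trans with i; auto. }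
  split; [exact hP|]; split; [exact ha1|]; split; [|split; [|split]].
  - destruct (not_null_meets C (fun _ => True) hn (open_full S) I) as [y [_ [h1 h2]]].
    destruct (ha2 y h1 h2) as [j [h3 _]]; eauto.
  - intros m hm; apply NNPP; intro hmax.
    assert (hle : forall j, P j -> le j m).
    { intros j hj; apply not_lt_le; intro h; apply hmax; eauto. }
    (* A last index [m] could be removed: uniting [a m] with every earlier [a j] covers [C] with
       indices below [m]. If [m] is also the first index, [a m] alone covers [C], which is then
       null. *)
    destruct (classic (exists j, lt j m)) as [[j0 hj0]|h0].
    + apply (hm m (or_introl eq_refl)); exists (fun j y => a j y \/ a m y); split.
      * intros j hj; destruct (ha1 m hm), (ha1 j (hP _ _ hm hj)); split; [apply clopen_or; auto|tauto].
      * intros y h1 h2; destruct (ha2 y h1 h2) as [j [h3 h4]].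
        destruct (hle j h3) as [-> |h5]; eauto.
    + apply hn; exists (fun y => ~ a m y); split; [apply ha1; auto|]; split; [apply ha1; auto|].
      intros y h1 h2 h3; destruct (ha2 y h2 h3) as [j [h4 h5]].
      destruct (hle j h4) as [-> |h6]; [auto|apply h0; eauto].
  - exact ha2.
  - intros i b hi hb; apply NNPP; intro h; apply (hi i (or_introl eq_refl)); exists b; split; auto.
    intros y h1 h2; apply NNPP; intro h3; apply h; exists y; split; [|split]; auto.
    intros j h4 h5; apply h3; eauto.
Qed.

(** Disjoint clopen pieces [e i] of [C] are halved, and [D] is glued to contain one half of each and
    avoid the other. As [e i] lies outside the earlier [a j], both parts of [C] escape every bounded
    stage, so neither is null. Minimality of the cover leaves room for [e i] at every stage. *)
Lemma not_null_split (C : S -> Prop) : punctured_clopen C -> ~ null C ->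
  exists D, punctured_clopen D /\ ~ null (fun y => C y /\ D y) /\ ~ null (fun y => C y /\ ~ D y).
Proof.
  intros hC hn.
  destruct (minimal_cover C hC hn) as [P [a [hP [ha [hne [hmax [hcov hmin]]]]]]].
  destruct (disjoint_pieces P a C hC ha hP hmin) as [e he].
  destruct (cond_choice K (S -> Prop) P (fun i d => clopen d /\ (exists y, e i y /\ d y) /\
    (exists y, e i y /\ ~ d y)) (fun _ => True)) as [d hd].
  { intros i hi; apply clopen_split; auto; apply he; auto. }
  assert (hT : forall (f : K -> S -> Prop) j, (forall i, P i -> clopen (f i)) -> P j ->
    type_lt small (fun y => (exists i, P i /\ (e i y /\ f i y)) /\ a j y)).
  { intros f j hf hj; apply type_lt_ext with (fun y => exists i, le i j /\ ((e i y /\ f i y) /\ a j y)).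
    - apply type_lt_seg_le; intros i hi.
      assert (hPi : P i) by (destruct hi as [-> |hi]; eauto).
      apply type_lt_clopen, clopen_and; [apply clopen_and; auto; apply he; auto|apply ha; auto].
    - intro y; split.
      + intros [i [hi h]]; split; [exists i; split; [destruct hi as [-> |hi]; eauto|]|]; tauto.
      + intros [[i [h1 h2]] h3]; exists i; split; auto; apply not_lt_le; intro h.
        apply (proj1 (proj2 (he i h1) j y h (proj1 h2)) h3). }
  destruct (clopen_gluing P a (fun y => exists i, P i /\ (e i y /\ d i y))
    (fun y => exists i, P i /\ (e i y /\ ~ d i y))) as [g [h1 [h2 h3]]]; auto.
  - intros j hj; apply ha; auto.
  - intros j hj; apply hT; auto; intros i hi; apply hd; auto.
  - intros j hj; apply (hT (fun i y => ~ d i y)); auto; intros i hi; apply clopen_not, hd; auto.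
  - intros y [[i [h1 [h2 h3]]] [j [h4 [h5 h6]]]]; destruct (lt_total i j) as [h|[-> |h]]; auto.
    + apply (proj2 (he j h4) i y h h5); auto.
    + apply (proj2 (he i h1) j y h h2); auto.
  - exists (fun y => g y /\ C y); split; [apply pc_of_pieces with P a; auto|].
    assert (hb : forall D, (forall y, D y -> C y) -> (forall i, P i -> exists y, e i y /\ D y) -> ~ null D).
    { intros D hDC hD hDn; destruct (null_bounded P a D C) as [m [hm1 hm2]]; auto.
      destruct (hD m hm1) as [y [h4 h5]].
      assert (hyx : y <> x) by (intros ->; apply (he m hm1); auto).
      destruct (hm2 y hyx h5) as [j [h6 [h7 h8]]]; apply (proj1 (proj2 (he m hm1) j y h7 h4)); auto. }
    split; apply hb; try tauto; intros i hi; destruct (hd i hi) as [h4 [[y [h5 h6]] [z [h7 h8]]]].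
    + exists y; split; auto.
      assert (hCy : C y) by (apply (proj1 (he i hi)); auto).
      assert (hyx : y <> x) by (intros ->; apply (proj1 (he i hi)); auto).
      destruct (hcov y hyx hCy) as [j [h9 h10]]; split; auto; split; auto.
      apply (h2 j); eauto.
    + exists z; split; auto.
      assert (hCz : C z) by (apply (proj1 (he i hi)); auto).
      split; auto; intros [h9 _]; apply (h3 z); eauto.
Qed.

(** * The remainder *)

Variable B : space.
Variable e : subspace (fun y : S => y <> x) -> B.
Hypothesis HB : stone_cech e.

Notation in_X y h := (exist (fun z : S => z <> x) y h).

Definition trace (W : B -> Prop) (y : S) : Prop := exists h : y <> x, W (e (in_X y h)).

Lemma trace_e (W : B -> Prop) (y : subspace (fun y : S => y <> x)) : trace W (proj1_sig y) <-> W (e y).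
Proof.
  destruct y as [y hy]; unfold trace; simpl; split; [|eauto].
  intros [h hW]; rewrite (proof_irrelevance _ hy h); exact hW.
Qed.

Lemma open_trace (W : B -> Prop) : open W -> open (trace W).
Proof.
  intro hW; destruct HB as [_ [_ [_ [hcont _]]]]; destruct (hcont W hW) as [O [hO hOe]].
  apply open_ext with (fun y => O y /\ y <> x).
  - apply open_inter; auto; apply hausdorff_open_ne; auto.
  - intro y; split.
    + intros [h1 h2]; exists h2; apply hOe; exact h1.
    + intros [h hy]; split; auto; apply (hOe (in_X y h)) in hy; exact hy.
Qed.

Lemma pc_trace (W : B -> Prop) : clopen W -> punctured_clopen (trace W).
Proof.
  intros [h1 h2]; apply open_trace in h1, h2; split.
  - apply (open_ext _ _ h1); intro y; split; [|tauto]; intros [h h']; split; auto; exists h; auto.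
  - apply (open_ext _ _ h2); intro y; split.
    + intros [h hW]; split; auto; intro h'; apply hW; apply (trace_e W (in_X y h)); auto.
    + intros [hW h]; exists h; intro h'; apply hW; exists h; auto.
Qed.

Lemma image_dense (W : B -> Prop) (b : B) : open W -> W b -> exists y h, W (e (in_X y h)).
Proof.
  intros hW hb; destruct HB as [_ [_ [_ [_ [_ [hd _]]]]]].
  destruct (hd W hW) as [[y h] hy]; eauto.
Qed.

Definition discrete_bool : space.
Proof.
  refine (@Space bool (fun _ => True) _ _ _); trivial.
Defined.

Definition extends (C : S -> Prop) (D : B -> Prop) : Prop :=
  clopen D /\ forall y h, D (e (in_X y h)) <-> C y.

Lemma extends_exists (C : S -> Prop) : punctured_clopen C -> exists D, extends C D.
Proof.
  intros [h1 h2]; destruct HB as [_ [_ [_ [_ [_ [_ huniv]]]]]].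
  pose (f := fun y : subspace (fun y : S => y <> x) =>
    (if excluded_middle_informative (C (proj1_sig y)) then true else false) : discrete_bool).
  destruct (huniv discrete_bool f) as [g [hg hge]].
  - intros F _ hF; destruct (hF true) as [U [h3 h4]], (hF false) as [V [h5 h6]].
    exists (U :: V :: nil); split; [intros W [<- |[<- |[]]]; auto|].
    intros []; [exists U | exists V]; simpl; auto.
  - intros a b hab; exists (eq a), (eq b); simpl; repeat split; auto.
    intros z [h3 h4]; congruence.
  - intros V _.
    exists (fun y => (V true /\ (C y /\ y <> x)) \/ (V false /\ (~ C y /\ y <> x))); split.
    + apply open_local; intros y [[hV hy]|[hV hy]]; [exists (fun y => C y /\ y <> x)|exists (fun y => ~ C y /\ y <> x)]; auto.
    + intros [y hy]; unfold f; simpl; destruct excluded_middle_informative; simpl; tauto.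
  - exists (fun b => g b = true); split; [split; [exact (hg (fun v => v = true) I)|exact (hg (fun v => v <> true) I)]|].
    intros y h; rewrite hge; unfold f; simpl; destruct excluded_middle_informative; split; auto; discriminate.
Qed.

(** It is applied to the graph of [e] over [C]: once along the compact [S] with [q] in [B], once
    along the compact [B] with [q = x]. *)
Lemma tube {Y Z : space} (T : Y -> Z -> Prop) (q : Z) : compact Y ->
  (forall p, exists U V, open U /\ open V /\ U p /\ V q /\ forall p' q', U p' -> V q' -> ~ T p' q') ->
  exists V, open V /\ V q /\ forall p q', V q' -> ~ T p q'.
Proof.
  intros hY h.
  destruct (hY (fun U => open U /\ exists V, open V /\ V q /\ forall p' q', U p' -> V q' -> ~ T p' q'))
    as [l [hl hlc]].
  - tauto.
  - intro p; destruct (h p) as [U [V [h1 [h2 [h3 [h4 h5]]]]]]; exists U; split; auto; split; eauto.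
  - assert (H : forall l', (forall U, In U l' -> open U /\ exists V, open V /\ V q /\
        forall p' q', U p' -> V q' -> ~ T p' q') ->
      exists V, open V /\ V q /\ forall U p q', In U l' -> U p -> V q' -> ~ T p q').
    { induction l' as [|U l' IH]; intro hl'; [exists (fun _ => True); split; [apply open_full|]; split; auto; intros U p q' []|].
      destruct IH as [V [h1 [h2 h3]]]; [intros W hW; apply hl'; right; auto|].
      destruct (hl' U (or_introl eq_refl)) as [_ [V' [h4 [h5 h6]]]].
      exists (fun z => V z /\ V' z); split; [apply open_inter; auto|]; split; auto.
      intros W p q' [<- |hW] hp [h7 h8]; eauto. }
    destruct (H l hl) as [V [h1 [h2 h3]]]; exists V; split; [|split]; auto.
    intros p q' hq; destruct (hlc p) as [U [h4 h5]]; eauto.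
Qed.

(** No point of [C] other than [x] is near [x], so [C] has closed image in [B]. A point [b] of [D]
    outside the range of [e] would have a neighbourhood missing that image, against density. *)
Lemma null_extends (C : S -> Prop) (D : B -> Prop) (b : B) : punctured_clopen C -> extends C D -> null C -> D b ->
  exists y, e y = b.
Proof.
  intros [_ hC] [hD hDe] [V [h1 [h2 h3]]] hb; apply NNPP; intro hn.
  destruct HB as [_ [hH _]].
  destruct (tube (fun y b' => C y /\ exists h, b' = e (in_X y h)) b S_compact) as [W [hW [hWb hWe]]].
  - intro y; destruct (classic (y = x)) as [-> |hy].
    + exists V, (fun _ => True); split; auto; split; [apply open_full|]; split; auto; split; auto.
      intros p q hp _ [h4 [h _]]; apply (h3 p); auto.
    + destruct (classic (C y)) as [h|h].
      * destruct (hH (e (in_X y hy)) b) as [U1 [U2 [h4 [h5 [h6 [h7 h8]]]]]]; [intro h'; apply hn; eauto|].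
        exists (trace U1), U2; split; [apply open_trace; auto|]; split; auto; split; [exists hy; auto|].
        split; auto; intros p q hp hq [_ [h9 ->]]; apply (h8 (e (in_X p h9))); split; auto.
        apply (trace_e U1 (in_X p h9)); auto.
      * exists (fun y => ~ C y /\ y <> x), (fun _ => True); split; auto; split; [apply open_full|].
        split; auto; split; auto; tauto.
  - destruct (image_dense (fun b => W b /\ D b) b) as [y [h [h4 h5]]]; auto.
    + apply open_inter; auto; apply hD.
    + apply (hWe y _ h4); split; [apply hDe in h5; auto|]; exists h; reflexivity.
Qed.

Lemma extends_null (C : S -> Prop) (D : B -> Prop) : extends C D ->
  (forall b, D b -> exists y, e y = b) -> null C.
Proof.
  intros [hD hDe] h; destruct HB as [hc [hH [hinj [hcont [hemb _]]]]].
  destruct (tube (fun b y => C y /\ exists h, b = e (in_X y h)) x hc) as [V [h1 [h2 h3]]].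
  - intro b; destruct (classic (D b)) as [hb|hb].
    + destruct (h b hb) as [[y hy] <-].
      destruct (S_hausdorff y x hy) as [U [V [h1 [h2 [h3 [h4 h5]]]]]].
      destruct (hemb (fun z => U (proj1_sig z)) (open_subspace_restrict _ U h1)) as [W [hW hWe]].
      exists W, V; split; auto; split; auto; split; [apply hWe; auto|]; split; auto.
      intros p q hp hq [_ [h6 ->]]; apply hWe in hp; apply (h5 q); auto.
    + exists (fun b => ~ D b), (fun _ => True); split; [apply hD|]; split; [apply open_full|].
      split; auto; split; auto; intros p q hp _ [h4 [h5 ->]]; apply hp, hDe, h4.
  - exists V; split; auto; split; auto; intros y hy hyx hC.
    apply (h3 (e (in_X y hyx)) y hy); split; auto; exists hyx; reflexivity.
Qed.

(** This is local compactness of the punctured space: a clopen set of [S] missing [x] is null, so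
    its extension stays inside the range of [e]. *)
Lemma image_open : open (fun b => exists y, e y = b).
Proof.
  apply open_local; intros b [[y hy] <-].
  destruct (zero_dim_nbhd (fun z => z <> x) y S_zero_dim) as [t [h1 [h2 h3]]]; auto using hausdorff_open_ne.
  destruct (extends_exists t (pc_of_clopen t h1)) as [D hD]; exists D; split; [apply hD|]; split.
  - apply hD; auto.
  - intros b hb; apply null_extends with t D; auto using pc_of_clopen.
    exists (fun z => ~ t z); split; [apply h1|]; split; [intro h; apply (h3 x); auto|]; auto.
Qed.

(** The closure of [U] is contained in [O]; the open [V] witnesses this without mentioning
    closures. *)
Definition well_inside (U O : B -> Prop) : Prop :=
  open U /\ exists V, open V /\ (forall b, ~ (U b /\ V b)) /\ (forall b, O b \/ V b).

Lemma well_inside_sub (U O : B -> Prop) : well_inside U O -> forall b, U b -> O b.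
Proof. intros [_ [V [_ [h1 h2]]]] b hb; destruct (h2 b); auto; destruct (h1 b); auto. Qed.

Lemma well_inside_nbhd (O : B -> Prop) (p : B) : open O -> O p -> exists U, U p /\ well_inside U O.
Proof.
  intros hO hp; destruct HB as [hc [hH _]].
  destruct (compact_hausdorff_normal (fun b => b = p) (fun b => ~ O b) hc hH) as [U [V [h1 [h2 [h3 [h4 h5]]]]]].
  - apply hausdorff_open_ne; auto.
  - apply (open_ext _ _ hO); intro b; split; [tauto|apply NNPP].
  - intros b [-> h]; auto.
  - exists U; split; auto; split; auto; exists V; split; auto; split; auto.
    intro b; destruct (classic (O b)); auto.
Qed.

Lemma well_inside_interpolate (U O : B -> Prop) : open O -> well_inside U O ->
  exists U', well_inside U U' /\ well_inside U' O.
Proof.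
  intros hO [hU [V [h1 [h2 h3]]]]; destruct HB as [hc [hH _]].
  destruct (compact_hausdorff_normal (fun b => ~ V b) (fun b => ~ O b) hc hH) as [U' [V' [h4 [h5 [h6 [h7 h8]]]]]].
  - apply (open_ext _ _ h1); intro b; split; [tauto|apply NNPP].
  - apply (open_ext _ _ hO); intro b; split; [tauto|apply NNPP].
  - intros b; destruct (h3 b); tauto.
  - exists U'; split; (split; auto).
    + exists V; split; auto; split; auto; intro b; destruct (classic (V b)); auto.
    + exists V'; split; auto; split; auto; intro b; destruct (classic (O b)); auto.
Qed.

Lemma well_inside_chain (U O : B -> Prop) : open O -> well_inside U O ->
  exists F : nat -> B -> Prop, F 0%nat = U /\ forall n, well_inside (F n) (F (n + 1)%nat) /\ well_inside (F n) O.
Proof.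
  intros hO h.
  destruct (cond_choice (B -> Prop) (B -> Prop) (fun U => well_inside U O)
    (fun U U' => well_inside U U' /\ well_inside U' O) (fun _ => True)) as [next hnext].
  { intros V hV; apply well_inside_interpolate; auto. }
  exists (fun n => Nat.iter n next U); split; [reflexivity|].
  assert (H : forall n, well_inside (Nat.iter n next U) O).
  { induction n as [|n IH]; simpl; auto; apply hnext; auto. }
  intro n; split; auto; rewrite Nat.add_1_r; simpl; apply hnext; auto.
Qed.

Lemma well_inside_clopen (U O : B -> Prop) (C : S -> Prop) : open O -> well_inside U O -> clopen C -> ~ C x ->
  exists d, clopen d /\ (forall y, C y -> trace U y -> d y) /\ (forall y, d y -> C y /\ trace O y).
Proof.
  intros hO [hU [V [h1 [h2 h3]]]] hC hx.
  destruct (compact_sep (fun y => C y /\ trace U y) (fun y => ~ (C y /\ trace O y)) S_compact) as [d [h4 [h5 h6]]].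
  - intro y; destruct (classic (C y)) as [hy|hy].
    + assert (hyx : y <> x) by (intros ->; auto).
      destruct (h3 (e (in_X y hyx))) as [h|h].
      * destruct (zero_dim_nbhd (fun y => C y /\ trace O y) y S_zero_dim) as [t [h7 [h8 h9]]].
        -- apply open_inter; [apply hC | apply open_trace; auto].
        -- split; auto; exists hyx; auto.
        -- exists t; split; [|split]; auto.
      * destruct (zero_dim_nbhd (trace V) y S_zero_dim) as [t [h7 [h8 h9]]].
        -- apply open_trace; auto.
        -- exists hyx; auto.
        -- exists t; split; [|split]; auto; left; intros z hz [_ [h10 h11]].
           apply h9 in hz; apply (trace_e V (in_X z h10)) in hz; apply (h2 _ (conj h11 hz)).
    + exists (fun y => ~ C y); split; [apply clopen_not; auto|]; split; auto; left; tauto.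
  - exists d; split; auto; split; auto; intros y hy; apply NNPP; intro h; apply (h6 y h hy).
Qed.

(** On [C] a clopen set fits between the traces of [F n] and [F (n + 1)], so the union of the chain
    is a countable union of clopen sets there. A single open set of [B] would not allow this. *)
Lemma type_lt_chain_trace (F : nat -> B -> Prop) (C : S -> Prop) : card_lt nat K ->
  (forall n, well_inside (F n) (F (n + 1)%nat)) -> clopen C -> ~ C x ->
  type_lt small (fun y => (exists n, trace (F n) y) /\ C y).
Proof.
  intros hK hF hC hx.
  assert (hd : forall n, exists d, clopen d /\ (forall y, C y -> trace (F n) y -> d y) /\
    (forall y, d y -> C y /\ trace (F (n + 1)%nat) y)).
  { intro n; apply well_inside_clopen; auto; apply (hF (n + 1)%nat). }
  apply choice_fun in hd; destruct hd as [d hd].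
  exists nat, d; split; auto; split; [intro n; apply hd|].
  intro y; split.
  - intros [[n h1] h2]; exists n; apply hd; auto.
  - intros [n h]; apply hd in h; split; [exists (n + 1)%nat|]; tauto.
Qed.

(** For uncountable [K] the unions of two chains have countable, hence small, type on each [c j],
    and [glue_cover] separates them. For countable [K] that type is too large, but countably many
    clopen sets then cover the punctured space; made disjoint, they allow separation piece by
    piece. *)
Lemma pc_between (U V O O' : B -> Prop) : open O -> open O' -> (forall b, ~ (O b /\ O' b)) ->
  well_inside U O -> well_inside V O' ->
  exists C, punctured_clopen C /\ (forall y, trace U y -> C y) /\ (forall y, trace V y -> ~ C y).
Proof.
  intros hO hO' hd hU hV.
  destruct (classic (card_lt nat K)) as [hK|hK].
  - destruct (well_inside_chain U O hO hU) as [F [hF0 hF]].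
    destruct (well_inside_chain V O' hO' hV) as [F' [hF0' hF']].
    destruct (glue_cover (fun y => exists n, trace (F n) y) (fun y => exists n, trace (F' n) y))
      as [g [h1 [h2 h3]]].
    + intro j; apply type_lt_chain_trace; auto; [intro n; apply hF|apply c_clopen|apply c_clopen].
    + intro j; apply type_lt_chain_trace; auto; [intro n; apply hF'|apply c_clopen|apply c_clopen].
    + intros y [[n [h1 h2]] [m h3]]; apply (trace_e (F' m) (in_X y h1)) in h3.
      apply (hd (e (in_X y h1))); split; [apply (well_inside_sub (F n))|apply (well_inside_sub (F' m))]; auto;
        [apply hF|apply hF'].
    + exists g; split; auto; split.
      * intros y hy; apply h2; [destruct hy; auto|]; exists 0%nat; rewrite hF0; auto.
      * intros y hy; apply h3; exists 0%nat; rewrite hF0'; auto.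
  - assert (hK' : card_le K nat) by (apply NNPP; intro h; apply hK; split; auto).
    destruct hK' as [f hf].
    (* The cover is reindexed by [nat], with the empty set at numbers outside the range of [f]. *)
    assert (hc : exists r : nat -> S -> Prop, (forall n, clopen (r n) /\ ~ r n x) /\
      forall y, y <> x -> exists n, r n y).
    { destruct (choice_fun nat (S -> Prop) (fun n r => (clopen r /\ ~ r x) /\ forall k, f k = n -> r = c k)) as [r hr].
      - intro n; destruct (classic (exists k, f k = n)) as [[k hk]|hn].
        + exists (c k); split; auto; intros k' hk'; f_equal; apply hf; congruence.
        + exists (fun _ => False); split; [split; [apply clopen_false|tauto]|]; intros k hk; destruct hn; eauto.
      - exists r; split; [apply hr|]; intros y hy; destruct (c_cover y hy) as [k hk].
        exists (f k); rewrite (proj2 (hr (f k)) k eq_refl); auto. }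
    destruct hc as [r [hr hrc]].
    assert (hdd : forall n, exists d, clopen d /\ (forall y, r n y -> trace U y -> d y) /\
      (forall y, d y -> r n y /\ trace O y)).
    { intro n; apply well_inside_clopen; auto; apply hr. }
    apply choice_fun in hdd; destruct hdd as [d hdd].
    assert (hq : forall n, clopen (fun y => forall m, (m < n)%nat -> ~ r m y)).
    { induction n as [|n IH].
      - apply clopen_ext with (fun _ => ~ False); [apply clopen_not, clopen_false|].
        intro y; split; [intros _ m hm; lia|tauto].
      - apply (clopen_ext _ _ (clopen_and _ _ IH (clopen_not _ (proj1 (hr n))))).
        intro y; split; [|intro h; split; auto].
        intros [h1 h2] m hm; assert (m = n \/ (m < n)%nat) as [-> |h3] by lia; auto. }
    assert (hfirst : forall y, y <> x -> exists n, r n y /\ forall m, (m < n)%nat -> ~ r m y).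
    { intros y hy; apply (wf_min nat _ Wf_nat.lt_wf); auto. }
    assert (huniq : forall y n m, r n y -> (forall m, (m < n)%nat -> ~ r m y) ->
      r m y -> (forall k, (k < m)%nat -> ~ r k y) -> m = n).
    { intros y n m h1 h2 h3 h4; destruct (Nat.lt_trichotomy m n) as [h|[h|h]]; auto.
      - destruct (h2 m h); auto.
      - destruct (h4 n h); auto. }
    (* The first [r n] through a point decides its membership. *)
    exists (fun y => exists n, d n y /\ forall m, (m < n)%nat -> ~ r m y); split; [split|split].
    + apply open_local; intros y [[n [h1 h2]] h3].
      exists (fun y => d n y /\ forall m, (m < n)%nat -> ~ r m y); split; [apply clopen_and; auto; apply hdd|].
      split; auto; intros z [h4 h5]; split; eauto; intros ->; apply (hr n), hdd; auto.
    + apply open_local; intros y [h1 h2]; destruct (hfirst y h2) as [n [h3 h4]].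
      exists (fun y => (~ d n y /\ r n y) /\ forall m, (m < n)%nat -> ~ r m y); split; [|split].
      * apply clopen_and; auto; apply clopen_and; [apply clopen_not, hdd|apply hr].
      * split; auto; split; auto; intro h; apply h1; eauto.
      * intros z [[h5 h6] h7]; split; [|intros ->; apply (hr n); auto].
        intros [m [h8 h9]]; apply h5.
        rewrite <- (huniq z n m); auto; apply hdd; auto.
    + intros y hy; destruct (hfirst y) as [n [h1 h2]]; [destruct hy; auto|].
      exists n; split; auto; apply hdd; auto.
    + intros y hy [n [h1 _]]; apply hdd in h1; destruct h1 as [_ [h2 h3]].
      apply (trace_e V (in_X y h2)) in hy; apply (hd (e (in_X y h2))); split; auto.
      apply (well_inside_sub V); auto.
Qed.

(** The two points get neighbourhoods well inside disjoint open sets. A clopen set between the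
    traces extends to [B], and density of the image carries the separation over to the points. *)
Lemma B_zero_dim : zero_dim B.
Proof.
  destruct HB as [hc [hH _]]; apply zero_dim_of_points; auto; intros p q hpq.
  destruct (hH p q hpq) as [O [O' [h1 [h2 [h3 [h4 h5]]]]]].
  destruct (well_inside_nbhd O p h1 h3) as [U [hUp hU]].
  destruct (well_inside_nbhd O' q h2 h4) as [V [hVq hV]].
  destruct (pc_between U V O O') as [C [h6 [h7 h8]]]; auto.
  destruct (extends_exists C h6) as [D [hD hDe]]; exists D; split; auto; split.
  - apply NNPP; intro h; destruct (image_dense (fun b => U b /\ ~ D b) p) as [y [hy [h9 h10]]]; auto.
    + apply open_inter; [apply hU|apply hD].
    + apply h10, hDe, h7; exists hy; auto.
  - intro h; destruct (image_dense (fun b => V b /\ D b) q) as [y [hy [h9 h10]]]; auto.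
    + apply open_inter; [apply hV|apply hD].
    + apply hDe in h10; apply (h8 y); auto; exists hy; auto.
Qed.

(** * The clopen algebra of the remainder *)

Notation type_le := (type_lt (fun I : Type => card_le I K)).

Lemma remainder_compact : compact (remainder e).
Proof.
  apply compact_subspace; [apply HB|]; apply (open_ext _ _ image_open).
  intro b; split; [tauto|apply NNPP].
Qed.

Lemma remainder_hausdorff : hausdorff (remainder e).
Proof. apply hausdorff_subspace, HB. Qed.

Lemma remainder_zero_dim : zero_dim (remainder e).
Proof. apply zero_dim_subspace, B_zero_dim. Qed.

(** This is the quotient map modulo null sets, kept as a relation so that no choice of extension is
    built in. *)
Definition represents (C : S -> Prop) (D : remainder e -> Prop) : Prop :=
  punctured_clopen C /\ exists E, extends C E /\ forall r, D r <-> E (proj1_sig r).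

Lemma represents_exists (C : S -> Prop) : punctured_clopen C -> exists D, represents C D.
Proof.
  intro hC; destruct (extends_exists C hC) as [E hE].
  exists (fun r => E (proj1_sig r)); split; auto; exists E; split; auto; tauto.
Qed.

Lemma represents_clopen (C : S -> Prop) (D : remainder e -> Prop) : represents C D -> clopen D.
Proof.
  intros [hC [E [[hE _] h]]].
  apply (clopen_ext (fun r : remainder e => E (proj1_sig r))); [apply clopen_subspace_restrict; auto|].
  intro r; symmetry; apply h.
Qed.

(** The remainder is closed in [B], the image being open; so [D] and its complement in the remainder
    have disjoint closures in [B], and a clopen [E] separates them there. *)
Lemma represents_of_clopen (D : remainder e -> Prop) : clopen D -> exists C, represents C D.
Proof.
  intros [[W [hW hWe]] [W' [hW' hWe']]].
  destruct (compact_sep (fun b => exists h, D (exist _ b h)) (fun b => exists h, ~ D (exist _ b h)))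
    as [E [h1 [h2 h3]]]; [apply HB| |].
  - intro b; destruct (classic (exists y, e y = b)) as [hb|hb].
    + destruct (zero_dim_nbhd _ b B_zero_dim image_open hb) as [V [h1 [h2 h3]]].
      exists V; split; [|split]; auto; left; intros z hz [h _]; apply h; auto.
    + destruct (classic (D (exist _ b hb))) as [h|h].
      * destruct (zero_dim_nbhd W b B_zero_dim hW) as [V [h1 [h2 h3]]]; [apply (hWe (exist _ b hb)); auto|].
        exists V; split; [|split]; auto; right; intros z hz [hz1 hz2]; apply hz2, hWe, h3, hz.
      * destruct (zero_dim_nbhd W' b B_zero_dim hW') as [V [h1 [h2 h3]]]; [apply (hWe' (exist _ b hb)); auto|].
        exists V; split; [|split]; auto; left; intros z hz [hz1 hz2].
        apply (hWe' (exist _ z hz1)); auto; apply h3, hz.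
  - exists (trace E); split; [apply pc_trace; auto|]; exists E; split; [split; auto|].
    + intros y h; symmetry; apply (trace_e E (in_X y h)).
    + intros [b hb]; simpl; split; intro h; [apply h2; eauto|].
      apply NNPP; intro h'; apply (h3 b); eauto.
Qed.

Lemma represents_not (C : S -> Prop) (D : remainder e -> Prop) :
  represents C D -> represents (fun y => ~ C y) (fun r => ~ D r).
Proof.
  intros [hC [E [[h1 h2] h3]]]; split; [apply pc_not; auto|].
  exists (fun b => ~ E b); split; [split; [apply clopen_not; auto|]|].
  - intros y h; rewrite h2; tauto.
  - intro r; rewrite h3; tauto.
Qed.

Lemma represents_and (C C' : S -> Prop) (D D' : remainder e -> Prop) :
  represents C D -> represents C' D' -> represents (fun y => C y /\ C' y) (fun r => D r /\ D' r).
Proof.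
  intros [hC [E [[h1 h2] h3]]] [hC' [E' [[h4 h5] h6]]]; split; [apply pc_and; auto|].
  exists (fun b => E b /\ E' b); split; [split; [apply clopen_and; auto|]|].
  - intros y h; rewrite h2, h5; tauto.
  - intro r; rewrite h3, h6; tauto.
Qed.

Lemma represents_null (C : S -> Prop) (D : remainder e -> Prop) :
  represents C D -> (null C <-> forall r, ~ D r).
Proof.
  intros [hC [E [hE hD]]]; split.
  - intros hn [b hb] h; apply hD in h; apply hb, (null_extends C E b); auto.
  - intro h; apply (extends_null C E hE); intros b hb; apply NNPP; intro hn.
    apply (h (exist _ b hn)), hD, hb.
Qed.

Lemma not_null_represents (C : S -> Prop) (D : remainder e -> Prop) :
  represents C D -> ~ null C -> exists r, D r.
Proof.
  intros h hn; apply NNPP; intro h'; apply hn, (represents_null C D h); intros r hr; apply h'; eauto.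
Qed.

Lemma represents_sub (C C' : S -> Prop) (D D' : remainder e -> Prop) :
  represents C D -> represents C' D' -> null (fun y => C y /\ ~ C' y) -> forall r, D r -> D' r.
Proof.
  intros h h' hn r hr; apply NNPP; intro hr'.
  apply (represents_null _ _ (represents_and _ _ _ _ h (represents_not _ _ h'))) with (r := r) in hn; auto.
Qed.

(** The results on families are indexed by [K] itself, so a family is padded with [C0]: the empty
    set for separation, the whole space for intersections. *)
Lemma family_representation (I : Type) (D : I -> remainder e -> Prop) (C0 : S -> Prop) :
  card_le I K -> (forall i, clopen (D i)) -> punctured_clopen C0 ->
  exists A : K -> S -> Prop, (forall k, punctured_clopen (A k)) /\
    (forall k, A k = C0 \/ exists i, represents (A k) (D i)) /\
    (forall i, exists k, represents (A k) (D i)).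
Proof.
  intros [f hf] hD hC0.
  destruct (choice_fun _ _ _ (fun i => represents_of_clopen (D i) (hD i))) as [C hC].
  destruct (choice_fun K (S -> Prop) (fun k A => (A = C0 /\ forall i, f i <> k) \/ exists i, f i = k /\ A = C i))
    as [A hA].
  { intro k; destruct (classic (exists i, f i = k)) as [[i hi]|h]; [exists (C i); eauto|].
    exists C0; left; split; auto; intros i hi; apply h; eauto. }
  exists A; split; [|split].
  - intro k; destruct (hA k) as [[-> _]|[i [_ ->]]]; auto; apply hC.
  - intro k; destruct (hA k) as [[-> _]|[i [_ ->]]]; eauto.
  - intro i; exists (f i); destruct (hA (f i)) as [[_ h]|[j [hj ->]]]; [destruct (h i eq_refl)|].
    apply hf in hj; subst j; auto.
Qed.

Lemma remainder_disjoint_sep (M N : remainder e -> Prop) : type_le M -> type_le N ->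
  (forall r, ~ (M r /\ N r)) ->
  exists d : remainder e -> Prop, clopen d /\ (forall r, M r -> d r) /\ (forall r, N r -> ~ d r).
Proof.
  intros [I [C [hI [hC hM]]]] [J [D [hJ [hD hN]]]] hd.
  destruct (family_representation I C (fun _ => False) hI hC) as [A [hA1 [hA2 hA3]]].
  { apply pc_of_clopen, clopen_false. }
  destruct (family_representation J D (fun _ => False) hJ hD) as [A' [hA1' [hA2' hA3']]].
  { apply pc_of_clopen, clopen_false. }
  destruct (families_sep A A' hA1 hA1') as [E [hE [h1 h2]]].
  - intros k l; destruct (hA2 k) as [-> |[i hi]]; [apply (null_mono _ _ null_False); tauto|].
    destruct (hA2' l) as [-> |[j hj]]; [apply (null_mono _ _ null_False); tauto|].
    apply (represents_null _ _ (represents_and _ _ _ _ hi hj)); intros r [h1 h2].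
    apply (hd r); split; [apply hM | apply hN]; eauto.
  - destruct (represents_exists E hE) as [d hd']; exists d; split; [apply (represents_clopen _ _ hd')|]; split.
    + intros r hr; apply hM in hr; destruct hr as [i hr]; destruct (hA3 i) as [k hk].
      apply (represents_sub (A k) E (C i) d); auto.
    + intros r hr; apply hN in hr; destruct hr as [j hr]; destruct (hA3' j) as [k hk].
      apply (represents_sub (A' k) (fun y => ~ E y) (D j) (fun r => ~ d r)); auto using represents_not.
      apply (null_mono _ _ (h2 k)); intros y _ [h3 h4]; split; auto; apply NNPP; auto.
Qed.

Lemma remainder_F : F_space (fun I : Type => card_le I K) (remainder e).
Proof.
  split; [apply remainder_zero_dim|]; intros U _ hU.
  apply (Cstar_embedded_of_sep K K_infinite (card_le_prod K K_infinite K_regular));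
    auto using remainder_compact, remainder_zero_dim, remainder_disjoint_sep.
Qed.

Lemma pc_full : punctured_clopen (fun _ => True).
Proof. apply pc_ext with (fun _ => ~ False); [apply pc_not, pc_of_clopen, clopen_false | tauto]. Qed.

(** Finite intersections of the representatives are not null, since the clopen sets they represent
    contain [p]. A pseudo-intersection then represents a non-empty clopen set inside every [O i]. *)
Lemma remainder_G : G_space (fun I : Type => card_le I K) (remainder e).
Proof.
  intros I O hI hO [p hp].
  destruct (choice_fun I (remainder e -> Prop) (fun i D => clopen D /\ D p /\ forall r, D r -> O i r)) as [D hD].
  { intro i; apply zero_dim_nbhd; auto using remainder_zero_dim. }
  destruct (family_representation I D (fun _ => True) hI) as [A [hA1 [hA2 hA3]]]; [apply hD|apply pc_full|].
  destruct (pseudo_intersection A hA1) as [C [hC [hn hs]]].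
  - intros l.
    assert (H : exists E, represents (fun y => forall k, In k l -> A k y) E /\ E p).
    { induction l as [|k l [E [h1 h2]]].
      - destruct (represents_exists (fun _ => True) pc_full) as [E hE].
        exists E; split.
        + destruct hE as [h1 h2]; split; [apply (pc_ext _ _ h1); simpl; tauto|].
          destruct h2 as [E' [[h3 h4] h5]]; exists E'; split; auto; split; auto.
          intros y h; rewrite h4; simpl; tauto.
        + apply NNPP; intro h; apply represents_not in hE.
          apply (represents_null _ _ hE) with (r := p); auto; apply (null_mono _ _ null_False); tauto.
      - assert (hk : exists E', represents (A k) E' /\ E' p).
        { destruct (hA2 k) as [hk|[i hi]]; [|exists (D i); split; auto; apply hD].
          rewrite hk; destruct (represents_exists (fun _ => True) pc_full) as [E' hE']; exists E'; split; auto.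
          apply NNPP; intro h; apply represents_not in hE'.
          apply (represents_null _ _ hE') with (r := p); auto; apply (null_mono _ _ null_False); tauto. }
        destruct hk as [E' [h3 h4]]; exists (fun r => E' r /\ E r); split; auto.
        assert (heq : (fun y => forall j, In j (k :: l) -> A j y) = (fun y => A k y /\ forall j, In j l -> A j y)).
        { apply set_ext; intro y; split; [intro h; split; [|intros j hj]; apply h; simpl; auto|].
          intros [h5 h6] j [<- |hj]; auto. }
        rewrite heq; apply represents_and; auto. }
    destruct H as [E [h1 h2]]; intro h; apply (represents_null _ _ h1) with (r := p) in h; auto.
  - destruct (represents_exists C hC) as [W hW]; exists W; split; [apply (represents_clopen _ _ hW)|]; split.
    + apply (not_null_represents _ _ hW hn).
    + intros r hr i; apply hD; destruct (hA3 i) as [k hk]; apply (represents_sub C (A k) W (D i)); auto.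
Qed.

(** An isolated point would form a clopen set with a non-null representative, and [not_null_split]
    would cut it into two disjoint non-empty parts. *)
Lemma remainder_perfect : no_isolated_points (remainder e).
Proof.
  intros p hp.
  destruct (represents_of_clopen (fun r => r = p)) as [C hC].
  { split; auto; apply hausdorff_open_ne, remainder_hausdorff. }
  destruct (not_null_split C) as [D [h1 [h2 h3]]]; [apply hC| |].
  - intro h; apply (represents_null _ _ hC) with (r := p) in h; auto.
  - destruct (represents_exists D h1) as [E hE].
    destruct (not_null_represents _ _ (represents_and _ _ _ _ hC hE) h2) as [r [-> hr]].
    destruct (not_null_represents _ _ (represents_and _ _ _ _ hC (represents_not _ _ hE)) h3) as [r [-> hr']].
    auto.
Qed.

Lemma remainder_nonempty : exists r : remainder e, True.
Proof.
  destruct (represents_exists _ pc_full) as [D hD].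
  destruct (not_null_represents _ _ hD) as [r _]; [|eauto].
  intros [V [h1 [h2 h3]]]; apply (S_perfect x); apply (open_ext _ _ h1).
  intro y; split; [intro h; apply NNPP; intro hy; apply (h3 y); auto | intros ->; auto].
Qed.

(** Away from [x], a clopen subset of the punctured space is the union of the base members of [S]
    inside it, so a chosen representative is coded by a subset of [K]. *)
Lemma remainder_clopen_count : weight S K ->
  card_le {D : remainder e -> Prop | clopen D} (K -> bool).
Proof.
  intros [[Bs [[hB1 hB2] [phi hphi]]] _].
  pose (inside := fun (C : S -> Prop) (k : K) => exists V : {U | Bs U}, phi V = k /\
    forall y, proj1_sig V y -> C y /\ y <> x).
  pose (code := fun (C : S -> Prop) (k : K) =>
    if excluded_middle_informative (inside C k) then true else false).
  assert (hcode : forall C C', punctured_clopen C -> code C = code C' -> forall y, y <> x -> C y -> C' y).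
  { intros C C' [hC _] h y hy hCy.
    destruct (hB2 _ hC y (conj hCy hy)) as [V [h1 [h2 h3]]].
    pose (k := phi (exist _ V h1)).
    assert (hin : inside C k) by (exists (exist _ V h1); auto).
    assert (h4 := f_equal (fun g => g k) h); unfold code in h4; simpl in h4.
    destruct (excluded_middle_informative (inside C k)); [|tauto].
    destruct (excluded_middle_informative (inside C' k)) as [[V' [h5 h6]]|]; [|discriminate].
    unfold k in h5; apply hphi in h5; subst V'; apply h6; auto. }
  destruct (choice_fun {D : remainder e -> Prop | clopen D} (S -> Prop)
    (fun D C => represents C (proj1_sig D))) as [rep hrep].
  { intros [D hD]; apply represents_of_clopen; auto. }
  assert (hsub : forall D D', code (rep D) = code (rep D') -> forall r, proj1_sig D r -> proj1_sig D' r).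
  { intros D D' h; apply (represents_sub (rep D) (rep D')); auto.
    apply (null_mono _ _ null_False); intros y hy [h1 h2]; apply h2.
    apply (hcode (rep D) (rep D')); auto; apply hrep. }
  exists (fun D => code (rep D)); intros D D' h.
  apply sig_eq, set_ext; intro r; split; apply hsub; auto.
Qed.

Lemma remainder_base_large (Bs : (remainder e -> Prop) -> Prop) : is_base Bs ->
  card_le (K -> bool) {U | Bs U}.
Proof.
  intros [_ hBs]; destruct remainder_nonempty as [r0 _].
  destruct (tree_of_open_sets K lt (remainder e) r0) as [O [hO1 hO2]];
    auto using remainder_compact, remainder_hausdorff, remainder_zero_dim, remainder_perfect, remainder_G.
  destruct (choice_fun (K -> bool) {U | Bs U} (fun f V => (exists r, proj1_sig V r) /\
    forall r, proj1_sig V r -> O f r)) as [V hV].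
  { intro f; destruct (hO1 f) as [h1 [r hr]]; destruct (hBs _ h1 r hr) as [V [h2 [h3 h4]]].
    exists (exist _ V h2); simpl; eauto. }
  exists V; intros f g h; destruct (hV f) as [[r hr] hf]; destruct (hV g) as [_ hg].
  apply (hO2 f g r); auto; apply hg; rewrite <- h; auto.
Qed.

End PuncturedSpace.

(** Members of a base of size at most [|K|] need not be clopen. Each one that fits into a clopen set
    missing [x] is replaced by such a set; all other indices get the empty set. *)
Lemma punctured_cover (K : Type) (S : space) (x : S) : zero_dim S -> hausdorff S -> weight S K ->
  exists c : K -> S -> Prop, (forall j, clopen (c j) /\ ~ c j x) /\ (forall y, y <> x -> exists j, c j y).
Proof.
  intros hz hH [[Bs [[hB1 hB2] [phi hphi]]] _].
  destruct (choice_fun K (S -> Prop) (fun k C => (clopen C /\ ~ C x) /\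
    forall V : {U | Bs U}, phi V = k -> (exists C', (clopen C' /\ ~ C' x) /\ forall y, proj1_sig V y -> C' y) ->
      forall y, proj1_sig V y -> C y)) as [c hc].
  { intro k; destruct (classic (exists V : {U | Bs U}, phi V = k /\
      exists C', (clopen C' /\ ~ C' x) /\ forall y, proj1_sig V y -> C' y)) as [[V [h1 [C [h2 h3]]]]|h].
    - exists C; split; auto; intros V' h4 _; assert (V' = V) as -> by (apply hphi; congruence); auto.
    - exists (fun _ => False); split; [split; [apply clopen_false|tauto]|].
      intros V h1 h2; destruct h; eauto. }
  exists c; split; [apply hc|]; intros y hy.
  destruct (zero_dim_nbhd (fun z => z <> x) y hz) as [C [h1 [h2 h3]]]; auto using hausdorff_open_ne.
  destruct (hB2 C (proj1 h1) y h2) as [V [h4 [h5 h6]]].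
  exists (phi (exist _ V h4)); apply (proj2 (hc _) (exist _ V h4)); auto.
  exists C; split; auto; split; auto; intro h; apply (h3 x); auto.
Qed.

Theorem theorem6p3
  (K : Type)
  (K_infinite : card_le nat K)
  (K_regular : forall L : Type, card_lt L K -> card_le (L -> K) K)
  (S : space)
  (S_par : parovicenko (fun I : Type => card_lt I K) S)
  (S_weight : weight S K)
  (x : S)
  (B : space)
  (e : subspace (fun y : S => y <> x) -> B)
  (HB : stone_cech e) :
  parovicenko (fun I : Type => card_le I K) (remainder e) /\
  weight (remainder e) (K -> bool).
Proof.
  destruct (cardinal_well_order K) as [lt [htr [htot [hwf hseg]]]].
  destruct S_par as [hc [hH [hz [hF [hG hp]]]]].
  destruct (punctured_cover K S x hz hH S_weight) as [c [hc1 hc2]].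
  assert (Z : zero_dim (remainder e)) by (eapply remainder_zero_dim; eauto).
  split; [split; [|split; [|split; [|split; [|split]]]]|split].
  - eapply remainder_compact; eauto.
  - eapply remainder_hausdorff; eauto.
  - exact Z.
  - eapply remainder_F; eauto.
  - eapply remainder_G; eauto.
  - eapply remainder_perfect; eauto.
  - exists (@clopen (remainder e)); split; auto; eapply remainder_clopen_count; eauto.
  - eapply remainder_base_large; eauto.
Qed.
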